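(* Let $G$ be a finite simple graph of order $n$. If $\sigma^*(G)\geq n$ (the value $\sigma^*(G)=+\infty$ being allowed), then either $G$ has a 2-proper partition $\mathcal{P}$ with $|\mathcal{P}|\leq \alpha^*(G)$, or $G$ is isomorphic to a graph in $\{K_2, F_5\}\cup\mathcal{F}_{11}\cup\mathcal{F}_{12}\cup\mathcal{H}_n$.
   Context: All graphs are finite and simple. A graph $H$ is 2-connected if $|V(H)|>2$ and $H-S$ is connected for every $S\subseteq V(H)$ with $|S|<2$. A 2-proper partition of $G$ is a partition $\mathcal{P}$ of $V(G)$ such that every $P\in\mathcal{P}$ induces a 2-connected subgraph of $G$. For an independent set $I$ of $G$, let $\delta_G(I)=\min\{d_G(u): u\in I\}$ and $w_G(I)=\sum_{u\in I}d_G(u)$. $I$ is large if $|I|\geq \delta_G(I)+1$, and light if $w_G(I)\leq |V(G)|-1$. $\sigma^*(G)=\min\{w_G(I): I \text{ a large independent set of } G\}$, with $\sigma^*(G)=+\infty$ if $G$ has no large independent set. $\alpha^*(G)=\max\{|I|: I \text{ a light independent set of } G\}$. Exceptional graphs: $F_5$ has vertex set $\{a,b_1,b_2,b_3,b_4\}$ and edge set $\{ab_1,ab_2,ab_3,ab_4,b_1b_2,b_3b_4\}$. $\mathcal{F}_{11}$ is the family of graphs with vertex set $\{a,b_1,b_2,c_1,\dots,c_8\}$ and edge set $\{ac_i: i\in[8]\}\cup\{b_1c_i: i\in[4]\}\cup\{b_2c_i: 5\le i\le 8\}\cup\{c_1c_2,c_3c_4,c_5c_6,c_7c_8\}\cup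 L$ where $L\subseteq\{ab_1,ab_2\}$. $\mathcal{F}_{12}$ is the family of graphs with vertex set $\{a,b_1,b_2,c_1,\dots,c_9\}$ and edge set $\{ac_i: i\in[8]\}\cup\{b_1c_i: i\in[4]\}\cup\{b_2c_i: 5\le i\le 8\}\cup\{c_1c_2,c_3c_4,c_5c_6,c_7c_9,c_8c_9\}\cup L$ where $L\subseteq\{ab_1,ab_2,ac_9,b_2c_9\}$ and $L\cap\{ac_9,b_2c_9\}\neq\emptyset$. For integers $2\le s\le t$, let $S_1,S_2$ be disjoint complete graphs of orders $s-1$ and $t-1$; $H_{s,t}$ is obtained from $S_1\cup S_2$ by adding new vertices $a,b,c_1,c_2$ and the edges $\{ax,bx: x\in V(S_1)\cup V(S_2)\}\cup\{ab,ac_1,ac_2,c_1c_2\}$; $H_{s,t}^-=H_{s,t}-ab$. For $n\ge 6$, $\mathcal{H}_n=\{H_{s,t},H_{s,t}^-: 2\le s\le t,\ s+t+2=n\}$. *)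

(* Defs.v *)
From mathcomp Require Import all_boot.
Set Implicit Arguments. Unset Strict Implicit. Unset Printing Implicit Defensive.

(* A finite simple graph is a symmetric irreflexive relation e on a finType T. *)
Section Graph.
Variables (T : finType) (e : rel T).

Definition deg (u : T) : nat := #|[set v | e u v]|.

Definition indep (I : {set T}) : bool :=
  [forall u in I, forall v in I, ~~ e u v].

(* delta_G(I) = min degree over I (default #|T| is only used for I = set0,
   and exceeds every degree, so it is the true minimum for nonempty I). *)
Definition delta (I : {set T}) : nat := \big[minn/#|T|]_(u in I) deg u.

Definition weight (I : {set T}) : nat := \sum_(u in I) deg u.

Definition large (I : {set T}) : bool := delta I + 1 <= #|I|.

(* w(I) <= |V(G)| - 1, stated without truncated subtraction *)
Definition light (I : {set T}) : bool := weight I + 1 <= #|T|.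

Definition large_indep (I : {set T}) : bool := indep I && large I.

(* sigma*(G) : None encodes +infinity (no large independent set).
   Default #|T|^2 of the min-fold exceeds every weight. *)
Definition sigma_star : option nat :=
  if [exists I : {set T}, large_indep I] then
    Some (\big[minn/(#|T| ^ 2)]_(I : {set T} | large_indep I) weight I)
  else None.

(* alpha*(G) = max size of a light independent set (0 if none, i.e. #|T| = 0) *)
Definition alpha_star : nat :=
  \max_(I : {set T} | indep I && light I) #|I|.

Definition induced (X : {set T}) : rel T :=
  fun x y => [&& e x y, x \in X & y \in X].

Definition connected_on (X : {set T}) : Prop :=
  forall x y, x \in X -> y \in X -> connect (induced X) x y.

Definition two_connected_on (X : {set T}) : Prop :=
  2 < #|X| /\ forall S : {set T}, S \subset X -> #|S| < 2 -> connected_on (X :\: S).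

Definition two_proper_partition (P : {set {set T}}) : Prop :=
  partition P [set: T] /\ forall B, B \in P -> two_connected_on B.

End Graph.

Definition isomorphic (T1 T2 : finType) (e1 : rel T1) (e2 : rel T2) : Prop :=
  exists f : T1 -> T2, bijective f /\ forall x y, e2 (f x) (f y) = e1 x y.

Definition edge_rel (n : nat) (s : seq (nat * nat)) : rel 'I_n :=
  fun x y => ((nat_of_ord x, nat_of_ord y) \in s) || ((nat_of_ord y, nat_of_ord x) \in s).
Arguments edge_rel : clear implicits.

Definition K2 : rel 'I_2 := edge_rel 2 [:: (0, 1)].

(* F_5 : a = 0, b_i = i *)
Definition F5 : rel 'I_5 :=
  edge_rel 5 [:: (0,1); (0,2); (0,3); (0,4); (1,2); (3,4)].

(* F_11 family : a = 0, b1 = 1, b2 = 2, c_i = 2 + i (i = 1..8).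
   l1 : ab1 in L, l2 : ab2 in L. *)
Definition F11 (l1 l2 : bool) : rel 'I_11 :=
  edge_rel 11
    ([:: (0,3); (0,4); (0,5); (0,6); (0,7); (0,8); (0,9); (0,10);
         (1,3); (1,4); (1,5); (1,6);
         (2,7); (2,8); (2,9); (2,10);
         (3,4); (5,6); (7,8); (9,10)]
     ++ (if l1 then [:: (0,1)] else [::])
     ++ (if l2 then [:: (0,2)] else [::])).

(* F_12 family : a = 0, b1 = 1, b2 = 2, c_i = 2 + i (i = 1..9).
   l1 : ab1, l2 : ab2, l3 : ac9, l4 : b2c9 in L; required l3 || l4. *)
Definition F12 (l1 l2 l3 l4 : bool) : rel 'I_12 :=
  edge_rel 12
    ([:: (0,3); (0,4); (0,5); (0,6); (0,7); (0,8); (0,9); (0,10);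
         (1,3); (1,4); (1,5); (1,6);
         (2,7); (2,8); (2,9); (2,10);
         (3,4); (5,6); (7,8); (9,11); (10,11)]
     ++ (if l1 then [:: (0,1)] else [::])
     ++ (if l2 then [:: (0,2)] else [::])
     ++ (if l3 then [:: (0,11)] else [::])
     ++ (if l4 then [:: (2,11)] else [::])).

(* H_{s,t} (withab = true) and H^-_{s,t} (withab = false) on 'I_(s+t+2):
   a = 0, b = 1, c1 = 2, c2 = 3, S1 = {4, ..., s+2} (s-1 vertices),
   S2 = {s+3, ..., s+t+1} (t-1 vertices). *)
Definition H_adj (s : nat) (withab : bool) (x y : nat) : bool :=
  let inS1 z := (4 <= z) && (z <= s + 2) in
  let inS2 z := s + 3 <= z in
  [|| (x == 0) && (4 <= y), (x == 1) && (4 <= y),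
      [&& withab, x == 0 & y == 1],
      (x == 0) && (y == 2), (x == 0) && (y == 3), (x == 2) && (y == 3),
      inS1 x && inS1 y | inS2 x && inS2 y].

Definition Hst (s t : nat) (withab : bool) : rel 'I_(s + t + 2) :=
  fun x y => (x != y) && (H_adj s withab x y || H_adj s withab y x).
Arguments F11 : clear implicits.
Arguments F12 : clear implicits.
Arguments Hst : clear implicits.
Arguments H_adj : clear implicits.

(* Main.v *)
Require Import Defs.
From mathcomp Require Import all_boot zify.
From Stdlib Require Import Classical.
Set Implicit Arguments. Unset Strict Implicit. Unset Printing Implicit Defensive.

(* Call #|J| - h the value of a profile (J, h), a light-like independent set J of an
   induced subgraph X (see [profile]). Every nonempty X satisfies one of: some profile has
   a value bounding the number of parts of a 2-proper partition of X; some profile has a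
   member of degree below its value; or X is exceptional, i.e. K2, a connected graph with a
   hanging triangle whose rest is connected but not 2-connected, or two of these joined at
   a vertex.

   For X the whole graph with sigma* >= n, all members of a profile have degree at least its
   value, for otherwise the members of smallest degree form a large independent set of
   weight less than n. So the second case is impossible, and in the first one deleting h
   members from J leaves a light independent set, whence the value is at most alpha*. In
   the exceptional case sigma* >= n is tight and forces the listed graphs.

   The trichotomy is proved by induction on X. Look for a component C of some X - w such
   that C + w has a partition into k parts while C has none, with C smallest. If there is
   none, every piece cut off by a vertex can be partitioned with or without that vertex,
   and X is assembled along maximal 2-connected subgraphs. Otherwise C + w can be
   partitioned cheaply, and the alternatives for C and for X - w - C are combined. *)

(* [lia] after dropping the hypotheses on set membership, which slow it down. *)
Ltac slia :=
  repeat match goal with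
  | H : is_true (leq _ _) |- _ => revert H
  | H : @eq nat _ _ |- _ => revert H
  end;
  repeat match goal with
  | H : ?P |- _ => lazymatch type of P with Prop => clear H end
  end; intros; lia.

(** The obstacle is the cut vertex. When independent sets from the two sides of w are united, every
    member may gain an edge to w, so the weight can grow by the number of members while only one
    vertex is added; light sets are not preserved. Profiles are, at the price of up to one unit of
    value per join. For a smallest failing component C that unit is regained: C has no partition
    into k parts, so a profile paying for a partition of C has value above k, whereas C + w needs
    only k parts. Minimality also ensures that pieces inside C which can be partitioned with their
    attachment vertex can be partitioned without it.

    In the exceptional graphs some member has degree equal to the value: 1 for K2, 2 for a hanging
    triangle, 3 for two of these joined. A join adds at most one to the degree and can take one off
    the sum of the values, so 2 and 2 only give 3 against 3. The list stops there because joining a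
    hanging triangle to such a pair gives value 4, while a tip of its triangle has degree at most
    3. *)

Lemma big_minn_le (I : eqType) (r : seq I) (P : pred I) (F : I -> nat) d i :
  i \in r -> P i -> \big[minn/d]_(j <- r | P j) F j <= F i.
Proof.
move=> + Pi; elim: r => // j r IH; rewrite inE big_cons => /orP[/eqP<-|/IH ir].
  by rewrite Pi geq_minl.
by case: ifP => // _; apply: leq_trans (geq_minr _ _) ir.
Qed.

(** * Isomorphism with a graph given by an explicit edge list *)

Definition non_edges n (L : seq (nat * nat)) : seq (nat * nat) :=
  [seq p <- flatten [seq [seq (i, j) | i <- iota 0 j] | j <- iota 0 n] | p \notin L].

Ltac compute_non_edges :=
  match goal with |- context [non_edges ?n ?L] =>
    let N := eval vm_compute in (non_edges n L) in
    change (non_edges n L) with N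
  end.

Section Iso.
Variables (T : finType) (e : rel T).
Hypotheses (e_sym : symmetric e) (e_irr : irreflexive e).

Lemma isomorphic_seq n (r : rel 'I_n) x0 (s : seq T) : (forall x, x \in s) -> size s = n -> #|T| = n ->
  (forall i j : 'I_n, r i j = e (nth x0 s i) (nth x0 s j)) -> isomorphic e r.
Proof.
move=> cov sz cT H.
have us : uniq s.
  by apply/card_uniqP; rewrite sz -cT; apply: eq_card => x; rewrite cov.
have lt x : index x s < n by rewrite -sz index_mem.
exists (fun x => Ordinal (lt x)); split; last by move=> x y; rewrite H /= !nth_index.
exists (fun i : 'I_n => nth x0 s i) => [x|i]; first by rewrite /= nth_index.
by apply: val_inj; rewrite /= index_uniq ?sz.
Qed.

(** Edges and non-edges are required as two concrete lists, so for a fixed graph both hypotheses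
    compute to finite conjunctions that are settled pair by pair. *)
Lemma isomorphic_edge_list n (L : seq (nat * nat)) x0 (s : seq T) :
  (forall x, x \in s) -> size s = n -> #|T| = n -> all (fun p => p.1 < p.2) L ->
  all (fun p => e (nth x0 s p.1) (nth x0 s p.2)) L ->
  all (fun p => ~~ e (nth x0 s p.1) (nth x0 s p.2)) (non_edges n L) ->
  isomorphic e (edge_rel n L).
Proof.
move=> cov sz cT /allP lL /allP eL /allP nL; apply: (isomorphic_seq (x0 := x0) cov sz cT).
have nin (i j : nat) : i <= j -> (j, i) \in L = false.
  by move=> ij; apply/negbTE/negP=> /lL /=; rewrite ltnNge ij.
have lt (i j : 'I_n) : i < j -> edge_rel n L i j = e (nth x0 s i) (nth x0 s j).
  move=> ij; rewrite /edge_rel (nin i j) 1?ltnW // orbF.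
  case: (boolP ((nat_of_ord i, nat_of_ord j) \in L)) => [/eL //|nij]; apply/esym/negbTE/(nL (nat_of_ord i, nat_of_ord j)).
  rewrite mem_filter nij; apply/flatten_mapP; exists (nat_of_ord j); first by rewrite mem_iota ltn_ord.
  by apply/mapP; exists (nat_of_ord i); rewrite ?mem_iota.
move=> i j; case: (ltngtP i j) => [|ji|ij]; first exact: lt.
  by rewrite /edge_rel orbC [RHS]e_sym; apply: lt.
by rewrite /edge_rel ij e_irr !nin.
Qed.

End Iso.

(** Normal form for ordered indices, with s = a + 1 so that the first clique occupies 4, ..., a + 3.
    The nested conditionals follow the blocks of the enumeration in [exc2_H]. *)
Lemma H_adj_le a k l u : k <= l ->
  (k != l) && (H_adj a.+1 u k l || H_adj a.+1 u l k) =
  (if k == 0 then if l == 1 then u else l != 0 else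
   if k == 1 then 3 < l else if k == 2 then l == 3 else
   [&& 3 < k, 3 < l, k != l & (l <= a + 3) || (a + 3 < k)]).
Proof.
rewrite /H_adj; case: k => [|[|[|k]]]; case: l => [|[|[|l]]] //=; case: u => //=; lia.
Qed.

Section Graph.
Variables (T : finType) (e : rel T).
Hypotheses (e_sym : symmetric e) (e_irr : irreflexive e).
Implicit Types (x y z r s u v w p q : T) (A B C D K Q R U V X Y Z I J S : {set T}).
Notation indep := (indep e).

(** * Connectivity inside a vertex set *)

(** These are the unions of components of the subgraph induced on X. *)
Definition clo X A : bool :=
  (A \subset X) && [forall x in A, forall y in X, e x y ==> (y \in A)].

Lemma cloP X A :
  reflect (A \subset X /\ forall x y, x \in A -> y \in X -> e x y -> y \in A)
          (clo X A).
Proof.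
apply: (iffP andP) => -[sAX H]; split=> //.
  by move=> x y xA yX exy; move/forall_inP/(_ x xA)/forall_inP/(_ y yX)/implyP: H; apply.
by apply/forall_inP=> x xA; apply/forall_inP=> y yX; apply/implyP; apply: H.
Qed.

Lemma clo_sub X A : clo X A -> A \subset X.
Proof. by case/cloP. Qed.

Lemma clo_mem X A x y : clo X A -> x \in A -> y \in X -> e x y -> y \in A.
Proof. by case/cloP=> _; apply. Qed.

Lemma clo_memr X A x y : clo X A -> x \in A -> y \in X -> e y x -> y \in A.
Proof. by rewrite e_sym; apply: clo_mem. Qed.

Lemma cloC X A : clo X A -> clo X (X :\: A).
Proof.
move=> cA; apply/cloP; split=> [|x y]; first exact: subsetDl.
rewrite !inE => /andP[xA xX] yX exy; rewrite yX andbT.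
by apply: contra xA => yA; apply: (clo_memr cA yA).
Qed.

Lemma clo_trans X A B : clo X A -> clo A B -> clo X B.
Proof.
move=> cA cB; apply/cloP; split=> [|x y xB yX exy].
  exact: subset_trans (clo_sub cB) (clo_sub cA).
apply: (clo_mem cB xB) => //; apply: (clo_mem cA) exy => //.
exact: (subsetP (clo_sub cB)).
Qed.

Lemma clo_cap X Y A : Y \subset X -> clo X A -> clo Y (A :&: Y).
Proof.
move=> sYX cA; apply/cloP; split=> [|x y]; first exact: subsetIr.
rewrite !inE => /andP[xA xY] yY exy; rewrite yY andbT.
exact: (clo_mem cA xA (subsetP sYX _ yY)).
Qed.

Lemma clo_subset X Y A : Y \subset X -> A \subset Y -> clo X A -> clo Y A.
Proof. by move=> sYX sAY /(clo_cap sYX); rewrite (setIidPl sAY). Qed.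

(** Connectedness without paths. The empty set counts as connected, as it does for
    [connected_on]. *)
Definition conn X : bool :=
  [forall A : {set T}, (A != set0) ==> clo X A ==> (A == X)].

Lemma connE X A : conn X -> clo X A -> A != set0 -> A = X.
Proof. by move=> /forallP/(_ A)/implyP H cA /H/implyP/(_ cA)/eqP. Qed.

Lemma connI X : (forall A, A != set0 -> clo X A -> A = X) -> conn X.
Proof. by move=> H; apply/forallP=> A; apply/implyP=> ?; apply/implyP=> ?; apply/eqP/H. Qed.

Lemma connN X : ~~ conn X ->
  exists A, [/\ clo X A, A != set0 & X :\: A != set0].
Proof.
case/forallPn=> A; rewrite !negb_imply => /and3P[A0 cA nA]; exists A; split=> //.
apply: contra nA; rewrite setD_eq0 => sXA.
by rewrite eqEsubset sXA (clo_sub cA).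
Qed.

Lemma conn1 x : conn [set x].
Proof.
apply: connI => A A0 /clo_sub sA; apply/eqP; rewrite eqEcard sA cards1.
by rewrite card_gt0.
Qed.

Lemma conn0 : conn set0.
Proof. by apply: connI => A A0 /clo_sub; rewrite subset0 => /eqP. Qed.

Lemma conn_comp X U : clo X U -> U != set0 ->
  exists K, [/\ K \subset U, K != set0, clo X K & conn K].
Proof.
have [n] := ubnP #|U|; elim: n U => // n IH U; rewrite ltnS => leU cU U0.
have [cnU|/connN[A [cA A0 nA]]] := boolP (conn U); first by exists U.
have sAU := clo_sub cA.
have ltA : #|A| < #|U|.
  by rewrite proper_card // properE sAU -setD_eq0.
have [||K [sKA K0 cK cnK]] := IH A _ _ A0; first lia.
- exact: clo_trans cU cA.
- by exists K; split=> //; apply: subset_trans sAU.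
Qed.

Lemma conn_link A B x y : conn A -> conn B -> x \in A -> y \in B -> e x y ->
  conn (A :|: B).
Proof.
move=> cA cB xA yB exy; apply: connI => D D0 cD.
have sA : A \subset A :|: B by apply: subsetUl.
have sB : B \subset A :|: B by apply: subsetUr.
have DA : D :&: A != set0 -> A \subset D.
  by move=> /(connE cA (clo_cap sA cD)) <-; apply: subsetIl.
have DB : D :&: B != set0 -> B \subset D.
  by move=> /(connE cB (clo_cap sB cD)) <-; apply: subsetIl.
have [z zD] := set0Pn _ D0; apply/eqP; rewrite eqEsubset (clo_sub cD) /=.
have := subsetP (clo_sub cD) _ zD; rewrite inE subUset => /orP[zA|zB].
  have sAD : A \subset D by apply: DA; apply/set0Pn; exists z; rewrite inE zD.
  rewrite sAD /=; apply: DB; apply/set0Pn; exists y; rewrite inE yB andbT.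
  by apply: (clo_mem cD) exy; [apply: (subsetP sAD)|apply: (subsetP sB)].
have sBD : B \subset D by apply: DB; apply/set0Pn; exists z; rewrite inE zD.
rewrite sBD andbT; apply: DA; apply/set0Pn; exists x; rewrite inE xA andbT.
by apply: (clo_memr cD) exy; [apply: (subsetP sBD)|apply: (subsetP sA)].
Qed.

Lemma conn_edge X A : conn X -> A \subset X -> A != set0 -> X :\: A != set0 ->
  exists x y, [/\ x \in A, y \in X :\: A & e x y].
Proof.
move=> cX sA A0 nA.
have : ~~ clo X A by apply: contra nA => /(connE cX)/(_ A0) ->; rewrite setDv.
rewrite /clo sA /= => /forall_inPn[x xA] /forall_inPn[y yX].
by rewrite negb_imply => /andP[exy yA]; exists x, y; rewrite !inE yA.
Qed.

(** The components of Q - s that remain keep their edges to s. Formally, a closed set of the rest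
    that contains s becomes closed in Q after adding K, and one that avoids s is already closed in
    Q. *)
Lemma conn_rem Q s K : conn Q -> s \in Q -> clo (Q :\ s) K -> conn (Q :\: K).
Proof.
move=> cQ sQ cK; apply: connI => A A0 cA.
have sKQ : K \subset Q by apply: subset_trans (clo_sub cK) (subsetDl _ _).
have sK : s \notin K by apply/negP=> /(subsetP (clo_sub cK)); rewrite !inE eqxx.
have [sA|sA] := boolP (s \in A).
  have : A :|: K = Q.
    apply: (connE cQ); last by apply/set0Pn; exists s; rewrite inE sA.
    apply/cloP; split=> [|x y].
      by rewrite subUset sKQ andbT (subset_trans (clo_sub cA)) ?subsetDl.
    rewrite !inE => xAK yQ exy; have [|yK] := boolP (y \in K); first by rewrite orbT.
    rewrite orbF; case/orP: xAK => [xA|xK].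
      by apply: (clo_mem cA) exy; rewrite // !inE yK.
    have [->//|ys] := eqVneq y s; case/negP: yK.
    by apply: (clo_mem cK) exy; rewrite // !inE ys.
  move=> <-; apply/setP=> x; rewrite !inE; case: (boolP (x \in K)) => //= xK.
    by apply/negP=> /(subsetP (clo_sub cA)); rewrite !inE xK.
  by rewrite orbF.
have AQ : A = Q.
  apply: (connE cQ) => //; apply/cloP; split=> [|x y xA yQ exy].
    by rewrite (subset_trans (clo_sub cA)) ?subsetDl.
  apply: (clo_mem cA) (exy) => //; rewrite !inE yQ andbT.
  have := subsetP (clo_sub cA) _ xA; rewrite !inE => /andP[xK xQ].
  apply: contra xK => yK; apply: (clo_memr cK yK) exy; rewrite !inE xQ andbT.
  by apply: contraNneq sA => <-.
by rewrite AQ sQ in sA.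
Qed.

Lemma connected_onP X : connected_on e X <-> conn X.
Proof.
have symi : connect_sym (induced e X).
  by apply: sym_connect_sym => x y; rewrite /induced e_sym [(y \in X) && _]andbC.
split=> [cX|cX x y xX yX].
  apply: connI => A A0 cA; apply/eqP; rewrite eqEsubset (clo_sub cA) /=.
  apply/subsetP=> y yX; have [x xA] := set0Pn _ A0.
  have clA : closed (induced e X) (mem A).
    move=> a b /and3P[eab aX bX]; apply/idP/idP => /= H.
      exact: (clo_mem cA H bX eab).
    exact: (clo_memr cA H aX eab).
  by have /(closed_connect clA)/= <- := cX x y (subsetP (clo_sub cA) _ xA) yX.
have : [set z in X | connect (induced e X) x z] = X.
  apply: (connE cX); last by apply/set0Pn; exists x; rewrite inE xX connect0.
  apply/cloP; split=> [|a b]; first by apply/subsetP=> a; rewrite inE => /andP[].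
  rewrite !inE => /andP[aX xa] bX eab; rewrite bX /=.
  by apply: connect_trans xa (connect1 _); rewrite /induced eab aX.
by move/setP/(_ y); rewrite inE yX.
Qed.

(** * 2-connected sets and partitions into them *)

Definition two_conn X : bool := [&& 2 < #|X|, conn X & [forall s in X, conn (X :\ s)]].

Lemma two_connP X : reflect [/\ 2 < #|X|, conn X & forall s, s \in X -> conn (X :\ s)] (two_conn X).
Proof. by apply: (iffP and3P) => -[? ? H]; split=> //; apply/forall_inP. Qed.

Lemma two_conn_two_connected_on X : two_conn X -> two_connected_on e X.
Proof.
case/two_connP=> c2 cX cXs; split=> // S sSX.
rewrite ltnS leq_eqVlt ltnS leqn0 cards_eq0 => /orP[/cards1P[s ES]|/eqP->].
  by rewrite ES; apply/connected_onP/cXs/(subsetP sSX); rewrite ES set11.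
by rewrite setD0; apply/connected_onP.
Qed.

Definition partitionable X (k : nat) : bool :=
  [exists P : {set {set T}}, [&& partition P X, [forall B in P, two_conn B] & #|P| <= k]].

Lemma partitionableP X k :
  reflect (exists P : {set {set T}}, [/\ partition P X, {in P, forall B, two_conn B} & #|P| <= k])
          (partitionable X k).
Proof.
apply: (iffP existsP) => -[P].
  by case/and3P=> ? /forall_inP ? ?; exists P.
by case=> ? ? ?; exists P; apply/and3P; split=> //; apply/forall_inP.
Qed.

Lemma partitionable_mono X k l : k <= l -> partitionable X k -> partitionable X l.
Proof. by move=> kl /partitionableP[P [pP tP cP]]; apply/partitionableP; exists P; split=> //; apply: leq_trans kl. Qed.

Lemma partitionable0 : partitionable set0 0.
Proof.
apply/partitionableP; exists set0; split; rewrite ?cards0 // ?partition_set0 // => B.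
by rewrite inE.
Qed.

Lemma partitionable1 X : two_conn X -> partitionable X 1.
Proof.
move=> tX; apply/partitionableP; exists [set X]; rewrite cards1; split=> // [|B]; last first.
  by rewrite inE => /eqP->.
apply/and3P; split; first by rewrite /cover big_set1.
  by apply/trivIsetP=> A B; rewrite !inE => /eqP-> /eqP->; rewrite eqxx.
rewrite inE eq_sym; apply: contraTneq tX => ->; apply/negP=> /two_connP[].
by rewrite cards0.
Qed.

Lemma partitionable1_two_conn X : X != set0 -> partitionable X 1 -> two_conn X.
Proof.
move=> X0 /partitionableP[P [pP tP]]; rewrite leq_eqVlt ltnS leqn0 => /orP[/cards1P[A EP]|].
  have <- := cover_partition pP; rewrite EP /cover big_set1; apply: tP.
  by rewrite EP inE.
rewrite cards_eq0 => /eqP EP; move: X0; rewrite -(cover_partition pP) EP.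
by rewrite /cover big_set0 eqxx.
Qed.

Lemma partitionable_gt0 X k : X != set0 -> partitionable X k -> 0 < k.
Proof.
move=> X0 /partitionableP[P [pP _ cP]]; apply: leq_trans cP; rewrite lt0n cards_eq0.
by apply: contraNneq X0 => P0; rewrite -(cover_partition pP) P0 /cover big_set0.
Qed.

Lemma partitionableU A B k l : [disjoint A & B] -> partitionable A k -> partitionable B l -> partitionable (A :|: B) (k + l).
Proof.
move=> dAB /partitionableP[P [pP tP cP]] /partitionableP[P' [pP' tP' cP']]; apply/partitionableP; exists (P :|: P').
split; last by rewrite (leq_trans (leq_card_setU _ _)) ?leq_add.
  case/and3P: (pP) => /eqP covP trP nP; case/and3P: (pP') => /eqP covP' trP' nP'.
  apply/and3P; split; last by rewrite inE negb_or nP.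
    by rewrite /cover bigcup_setU; apply/eqP; congr (_ :|: _).
  have dis X Y : X \in P -> Y \in P' -> [disjoint X & Y].
    move=> XP YP; apply: disjointW dAB; [rewrite -covP|rewrite -covP'].
      exact: (bigcup_sup X).
    exact: (bigcup_sup Y).
  apply/trivIsetP=> X Y; rewrite !inE => /orP[XP|XP] /orP[YP|YP] nXY.
  - exact: (trivIsetP trP).
  - exact: dis.
  - by rewrite disjoint_sym; apply: dis.
  - exact: (trivIsetP trP').
by move=> X; rewrite inE => /orP[/tP|/tP'].
Qed.

(** * Degrees, independent sets and profiles *)

Lemma card_disjU A B : [disjoint A & B] -> #|A :|: B| = #|A| + #|B|.
Proof. by rewrite -(leq_card_setU A B).2 => /eqP. Qed.

Lemma sum_disjU A B (F : T -> nat) : [disjoint A & B] ->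
  \sum_(x in A :|: B) F x = \sum_(x in A) F x + \sum_(x in B) F x.
Proof.
move=> dAB; rewrite (big_setID A) /=; congr (_ + _); apply: eq_bigl => x.
  by rewrite !inE; case: (x \in A) => //; rewrite andbF.
by rewrite !inE; case: (boolP (x \in A)) => //= xA; rewrite (disjointFr dAB xA).
Qed.

Definition dg X x := #|[set y in X | e x y]|.

Lemma dg_le_card X A x : (forall y, y \in X -> e x y -> y \in A) -> dg X x <= #|A|.
Proof. by move=> H; apply: subset_leq_card; apply/subsetP=> y; rewrite inE => /andP[/H]; apply. Qed.

Lemma dg_lt X x : x \in X -> dg X x < #|X|.
Proof.
move=> xX; rewrite (cardsD1 x X) xX add1n ltnS; apply: dg_le_card => y yX exy.
by rewrite !inE yX andbT; apply: contraTneq exy => ->; rewrite e_irr.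
Qed.

Lemma dgS X Y x : X \subset Y -> dg X x <= dg Y x.
Proof.
move=> sXY; apply: subset_leq_card; apply/subsetP=> y; rewrite !inE.
by case/andP=> /(subsetP sXY)->.
Qed.

Lemma dgU A B x : dg (A :|: B) x <= dg A x + dg B x.
Proof.
rewrite /dg; apply: leq_trans (leq_card_setU _ _); apply: subset_leq_card.
by apply/subsetP=> y; rewrite !inE andb_orl.
Qed.

Lemma dg1 w x : dg [set w] x = e x w.
Proof.
rewrite /dg; case: (boolP (e x w)) => exw; last first.
  by apply/eqP; rewrite cards_eq0; apply/set0Pn=> -[y]; rewrite !inE => /andP[/eqP->]; apply/negP.
by rewrite /= -(cards1 w); apply: eq_card => y; rewrite !inE; case: eqP => // ->.
Qed.

Lemma dgU1 w A x : dg (w |: A) x <= dg A x + e x w.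
Proof. by rewrite (leq_trans (dgU _ _ _)) // dg1 addnC. Qed.

Lemma dgU1n w A x : ~~ e x w -> dg (w |: A) x <= dg A x.
Proof. by move=> nxw; have := dgU1 w A x; rewrite (negbTE nxw) addn0. Qed.

Lemma dg_cloE X A x : clo X A -> x \in A -> dg X x = dg A x.
Proof.
move=> cA xA; apply/eqP; rewrite eqn_leq (dgS x (clo_sub cA)) andbT.
apply: subset_leq_card; apply/subsetP=> y; rewrite !inE => /andP[yX exy].
by rewrite exy andbT; apply: clo_mem cA _ _ exy.
Qed.

Lemma dgD1_clo X w A x : w \in X -> clo (X :\ w) A -> x \in A -> dg X x <= dg A x + e x w.
Proof.
move=> wX cA xA; rewrite -(dg_cloE cA xA).
by rewrite -{1}(setD1K wX); apply: dgU1.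
Qed.

Lemma dg_gt0 X x : 0 < dg X x -> exists2 y, y \in X & e x y.
Proof. by case/card_gt0P=> y; rewrite inE => /andP[]; exists y. Qed.

Lemma edge_dg_gt0 X x y : y \in X -> e x y -> 0 < dg X x.
Proof. by move=> yX exy; apply/card_gt0P; exists y; rewrite inE yX. Qed.

Definition wt X J := \sum_(x in J) dg X x.

Lemma wtU X J K : [disjoint J & K] -> wt X (J :|: K) = wt X J + wt X K.
Proof. exact: sum_disjU. Qed.

Lemma wt1 X x : wt X [set x] = dg X x.
Proof. by rewrite /wt big_set1. Qed.

Lemma wtU1 X J x : x \notin J -> wt X (x |: J) = dg X x + wt X J.
Proof. exact: big_setU1. Qed.

Lemma wtS X I J : I \subset J -> wt X I <= wt X J.
Proof.
move=> sIJ; by rewrite {2}/wt (big_setID I) /= (setIidPr sIJ) leq_addr.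
Qed.

Lemma wt_le X Y J c : (forall x, x \in J -> dg X x <= dg Y x + c) ->
  wt X J <= wt Y J + c * #|J|.
Proof.
move=> H; rewrite /wt mulnC -sum_nat_const -big_split /=.
exact: leq_sum.
Qed.

Lemma wt_eq X Y J : (forall x, x \in J -> dg X x = dg Y x) -> wt X J = wt Y J.
Proof. by move=> H; apply: eq_bigr. Qed.

(** Members other than u are discarded one at a time, each taking at least d off the weight. Keeping
    u preserves a chosen vertex of smallest degree. *)
Lemma wt_drop X J u (q d : nat) : u \in J -> 0 < q <= #|J| ->
  (forall x, x \in J -> d <= dg X x) ->
  exists I, [/\ I \subset J, u \in I, #|I| = q & wt X I + (#|J| - q) * d <= wt X J].
Proof.
move=> uJ; move En: (#|J| - q) => n.
elim: n J En uJ => [|n IH] J En uJ qJ Hd; first by exists J; split=> //; lia.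
have [y yJu] : exists y, y \in J :\ u.
  by apply/set0Pn; rewrite -cards_eq0; have := cardsD1 u J; rewrite uJ; lia.
have := yJu; rewrite inE => /andP[]; rewrite !inE => yu yJ.
have cJ := cardsD1 y J; rewrite yJ in cJ.
have [||||I [sI uI cI wI]] := IH (J :\ y).
- lia.
- by rewrite !inE eq_sym yu.
- lia.
- by move=> x; rewrite !inE => /andP[_ /Hd].
exists I; split=> //; first by apply: subset_trans sI (subsetDl _ _).
rewrite {2}/wt (big_setD1 y yJ) /= -/(wt X (J :\ y)).
have := Hd y yJ; lia.
Qed.

Lemma indepP I : reflect (forall x y, x \in I -> y \in I -> ~~ e x y) (indep I).
Proof.
apply: (iffP forall_inP) => [H x y xI yI|H x xI].
  by have /forall_inP := H x xI; apply.
by apply/forall_inP=> y yI; apply: H.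
Qed.

Lemma indepS I J : I \subset J -> indep J -> indep I.
Proof.
move=> sIJ /indepP H; apply/indepP=> x y xI yI.
by apply: H; apply: (subsetP sIJ).
Qed.

Lemma indep1 x : indep [set x].
Proof. by apply/indepP=> y z; rewrite !inE => /eqP-> /eqP->; rewrite e_irr. Qed.

Definition noedge A B := forall x y, x \in A -> y \in B -> ~~ e x y.

Lemma noedge_sym A B : noedge A B -> noedge B A.
Proof. by move=> H x y xB yA; rewrite e_sym; apply: H. Qed.

Lemma noedgeS A B A' B' : A' \subset A -> B' \subset B -> noedge A B -> noedge A' B'.
Proof. by move=> sA sB H x y /(subsetP sA) xA /(subsetP sB) yB; apply: H. Qed.

Lemma indepU I J : indep I -> indep J -> noedge I J -> indep (I :|: J).
Proof.
move=> /indepP iI /indepP iJ nIJ; apply/indepP=> x y; rewrite !inE.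
case/orP=> xI /orP[] yI; [exact: iI|exact: nIJ|rewrite e_sym; exact: nIJ|exact: iJ].
Qed.

Lemma indepU1 x J : indep J -> (forall y, y \in J -> ~~ e x y) -> indep (x |: J).
Proof.
move=> iJ H; apply: indepU => //; first exact: indep1.
by move=> a y; rewrite inE => /eqP->; apply: H.
Qed.

Lemma indep2 x y : ~~ e x y -> indep [set x; y].
Proof. by move=> nxy; apply: indepU1; [apply: indep1|move=> z; rewrite inE => /eqP->]. Qed.

Lemma noedge_clo X A : clo X A -> noedge A (X :\: A).
Proof.
move=> cA x y xA; rewrite inE => /andP[yA yX]; apply: contra yA => exy.
exact: clo_mem cA xA yX exy.
Qed.

Lemma clo_noedge A B : noedge A B -> clo (A :|: B) A.
Proof.
move=> nAB; apply/cloP; split=> [|x y xA]; first exact: subsetUl.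
by rewrite inE => /orP[//|yB] exy; have := nAB x y xA yB; rewrite exy.
Qed.

Lemma dg_noedgel A B x : noedge A B -> x \in A -> dg (A :|: B) x = dg A x.
Proof. by move=> /clo_noedge; apply: dg_cloE. Qed.

Lemma dg_noedger A B x : noedge A B -> x \in B -> dg (A :|: B) x = dg B x.
Proof. by rewrite setUC => /noedge_sym/clo_noedge; apply: dg_cloE. Qed.

(* The value of the profile is #|J| - h. Each cut vertex at which two profiles are
   joined raises h by one; the slack h * (#|J| - 1 - h) in the weight pays for the
   edges to these cut vertices, and is exactly what deleting h members of degree at
   least the value recovers. The last two clauses handle members of degree at most h. *)
Record profile X J (h : nat) : Prop := Profile {
  prof_sub : J \subset X;
  prof_indep : indep J;
  prof_card : (h == 0) && (0 < #|J|) || (2 * h + 2 <= #|J|);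
  prof_wt : wt X J + 1 <= #|X| + h * (#|J| - 1 - h);
  prof_small : forall m u, m <= h -> u \in J -> (forall x, x \in J -> m <= dg X x) ->
    exists I, [/\ I \subset J, u \notin I, #|I| = m & wt X I + m + 1 <= #|X|];
  prof_pair : 1 < #|J| -> exists x y,
    [/\ x \in J, y \in J, x != y & dg X x + dg X y + 1 <= #|X|] }.

Lemma prof_gt0 X J h : profile X J h -> h < #|J|.
Proof. by case=> _ _ + _ _ _; case/orP=> [/andP[/eqP->]//|]; lia. Qed.

Lemma prof_mem X J h : profile X J h -> exists x, x \in J.
Proof. by move=> /prof_gt0 H; apply/set0Pn; rewrite -card_gt0; lia. Qed.

Lemma profile0 X J : J \subset X -> indep J -> 0 < #|J| -> wt X J + 1 <= #|X| ->
  profile X J 0.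
Proof.
move=> sJX iJ J0 wJ; split=> //; [by rewrite J0|by rewrite mul0n addn0| |].
  move=> m u; rewrite leqn0 => /eqP-> uJ _; exists set0.
  by rewrite sub0set inE cards0 /wt big_set0; split=> //; lia.
case/card_gt1P=> x [y] [xJ yJ nxy]; exists x, y; split=> //.
apply: leq_trans wJ; rewrite leq_add2r -!wt1 -wtU.
  by apply: wtS; rewrite subUset !sub1set xJ.
by rewrite disjoints1 inE.
Qed.

(** At the same h the slack grows by h * #|J|, which covers the slack of the second profile because
    k <= h. *)
Lemma profileU X Y I J h k : [disjoint X & Y] -> noedge X Y -> k <= h ->
  profile X I h -> profile Y J k -> profile (X :|: Y) (I :|: J) h.
Proof.
move=> dXY nXY kh pI pJ; have [sI iI cI wI smI prI] := pI; have [sJ iJ cJ wJ _ prJ] := pJ.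
have dIJ : [disjoint I & J] by apply: disjointW dXY.
have dgI x : x \in I -> dg (X :|: Y) x = dg X x.
  by move=> /(subsetP sI); apply: dg_noedgel.
have dgJ x : x \in J -> dg (X :|: Y) x = dg Y x.
  by move=> /(subsetP sJ); apply: dg_noedger.
have cU : #|I :|: J| = #|I| + #|J| by rewrite card_disjU.
have wU : wt (X :|: Y) (I :|: J) = wt X I + wt Y J.
  by rewrite wtU // (wt_eq dgI) (wt_eq dgJ).
have J0 := prof_gt0 pJ; have I0 := prof_gt0 pI.
split.
- exact: setUSS.
- by apply: indepU => //; apply: noedgeS nXY.
- by rewrite cU; case/orP: cI; [case/andP=> ->; rewrite addn_gt0 => ->|move=> H; apply/orP; right; slia].
- rewrite wU cU card_disjU //.
  have : k * (#|J| - 1 - k) <= h * #|J| by apply: leq_mul => //; slia.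
  have -> : #|I| + #|J| - 1 - h = #|I| - 1 - h + #|J| by slia.
  by rewrite mulnDr; slia.
- move=> {cI cJ wI wJ wU} m u mh uIJ dm.
  (* u0 equals u if u lies in I and is arbitrary in I otherwise, so a subset of I that avoids u0
     avoids u. *)
  have [u0 u0I u0u] : exists2 u0, u0 \in I & (u \in I -> u0 = u).
    have [uI|uI] := boolP (u \in I); first by exists u.
    by have [u0] := prof_mem pI; exists u0.
  have [|K [sK uK cK wK]] := smI m u0 mh u0I.
    by move=> x xI; rewrite -dgI // dm // inE xI.
  exists K; split=> //; first by apply: subset_trans sK (subsetUl _ _).
    by apply: contra uK => uK; rewrite u0u //; apply: (subsetP sK).
  rewrite card_disjU // (@wt_eq _ X) => [|x xK]; first slia.
  by apply: dgI; apply: (subsetP sK).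
move=> {cI cJ wI wJ wU smI} cIJ; rewrite cU in cIJ; have [I1|I1] := ltnP 1 #|I|.
  have [x [y [xI yI nxy dxy]]] := prI I1; exists x, y.
  by rewrite !inE xI yI !dgI //; split=> //; rewrite card_disjU //; slia.
have [x xI] := prof_mem pI; have [y yJ] := prof_mem pJ; exists x, y.
rewrite !inE xI yJ orbT; split=> //.
  by apply: contraTneq yJ => <-; rewrite (disjointFr dIJ).
rewrite dgI // dgJ // card_disjU //.
have := dg_lt (subsetP sI _ xI); have := dg_lt (subsetP sJ _ yJ); slia.
Qed.

(** Up to #|I| + #|J| new edges lead to w. Raising h by one enlarges the slack just enough to pay
    for them; for h = k = 0 the count has no room to spare. *)
Lemma profileU1 w X Y I J h k : w \notin X :|: Y -> [disjoint X & Y] -> noedge X Y ->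
  k <= h -> 1 < #|I| -> 1 < #|J| ->
  profile X I h -> profile Y J k -> profile (w |: (X :|: Y)) (I :|: J) h.+1.
Proof.
move=> wXY dXY nXY kh I1 J1 pI pJ.
have [sI iI cI wI smI prI] := pI; have [sJ iJ cJ wJ _ prJ] := pJ.
have dIJ : [disjoint I & J] by apply: disjointW dXY.
have dgI x : x \in I -> dg (w |: (X :|: Y)) x <= dg X x + 1.
  move=> /(subsetP sI) xX; rewrite -(dg_noedgel nXY xX).
  by rewrite (leq_trans (dgU1 _ _ _)) // leq_add2l leq_b1.
have dgJ x : x \in J -> dg (w |: (X :|: Y)) x <= dg Y x + 1.
  move=> /(subsetP sJ) xX; rewrite -(dg_noedger nXY xX).
  by rewrite (leq_trans (dgU1 _ _ _)) // leq_add2l leq_b1.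
have cU : #|I :|: J| = #|I| + #|J| by rewrite card_disjU.
have cX : #|w |: (X :|: Y)| = #|X| + #|Y| + 1.
  by rewrite cardsU1 wXY card_disjU //; slia.
have wU : wt (w |: (X :|: Y)) (I :|: J) <= wt X I + wt Y J + #|I| + #|J|.
  rewrite wtU //; have := wt_le dgI; have := wt_le dgJ; slia.
have J0 := prof_gt0 pJ; have I0 := prof_gt0 pI.
split.
- by apply: subset_trans (subsetUr _ _); apply: setUSS.
- by apply: indepU => //; apply: noedgeS nXY.
- have cI' : 2 * h + 2 <= #|I| by case/orP: cI => // /andP[/eqP-> _].
  by apply/orP; right; rewrite cU; slia.
- have kJ : k * (#|J| - 1 - k) <= h * (#|J| - 2).
    by case: (posnP k) => [->//|k0]; apply: leq_mul => //; slia.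
  have -> : #|I :|: J| - 1 - h.+1 = (#|I| - 1 - h) + (#|J| - 2).+1 by slia.
  by rewrite cX mulSn mulnDr mulnS; slia.
- move=> {cI cJ wI wJ wU} [|m] u mh uIJ dm.
    by exists set0; rewrite sub0set inE cards0 /wt big_set0; split=> //; slia.
  have [u0 u0I u0u] : exists2 u0, u0 \in I & (u \in I -> u0 = u).
    have [uI|uI] := boolP (u \in I); first by exists u.
    by have [u0] := prof_mem pI; exists u0.
  have [||K [sK uK cK wK]] := smI m u0 _ u0I; first slia.
    by move=> x xI; have := dgI _ xI; have := dm x; rewrite inE xI => /(_ isT); slia.
  (* y supplies the last of the m + 1 members. Both vertices from [prof_pair] have degree at least m
     in Y, hence at most #|Y| - 1 - m, and one of them differs from u. *)
  have [y [yJ yu dy]] : exists y, [/\ y \in J, y != u & dg Y y + m.+1 <= #|Y|].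
    have [x [y [xJ yJ nxy dxy]]] := prJ J1.
    have dmJ z : z \in J -> m <= dg Y z.
      by move=> zJ; have := dgJ _ zJ; have := dm z; rewrite inE zJ orbT => /(_ isT); slia.
    have [xu|xu] := eqVneq x u.
      exists y; split=> //; first by rewrite -xu eq_sym.
      by have := dmJ x xJ; slia.
    by exists x; split=> //; have := dmJ y yJ; slia.
  have yK : y \notin K by apply/negP=> /(subsetP sK) yI; rewrite (disjointFr dIJ yI) in yJ.
  exists (y |: K); split.
  - by rewrite subUset sub1set inE yJ orbT (subset_trans sK) ?subsetUl.
  - rewrite !inE negb_or eq_sym yu /=; apply: contra uK => uK.
    by rewrite u0u //; apply: (subsetP sK).
  - by rewrite cardsU1 yK cK.
  rewrite wtU1 // cX.
  have := dgJ y yJ.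
  have : wt (w |: (X :|: Y)) K <= wt X K + 1 * #|K|.
    by apply: wt_le => x /(subsetP sK); apply: dgI.
  slia.
move=> {cI cJ wI wJ wU} _; have [x xI] := prof_mem pI; have [y yJ] := prof_mem pJ; exists x, y.
rewrite !inE xI yJ orbT; split=> //.
  by apply: contraTneq yJ => <-; rewrite (disjointFr dIJ).
have := dgI x xI; have := dgJ y yJ; rewrite cX.
have := dg_lt (subsetP sI _ xI); have := dg_lt (subsetP sJ _ yJ); slia.
Qed.

(** The set grows at unchanged h, so the value rises by one. Two nonadjacent vertices of small
    degree sum will make this affordable. *)
Lemma profile_add X J h y : profile X J h -> y \in X -> y \notin J ->
  (forall x, x \in J -> ~~ e y x) ->
  0 < h -> wt X (y |: J) + 1 <= #|X| + h * (#|J| - h) -> profile X (y |: J) h.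
Proof.
move=> pJ yX yJ ny h0 wJ; have [sJ iJ cJ _ smJ prJ] := pJ.
have cy : #|y |: J| = #|J|.+1 by rewrite cardsU1 yJ.
have cJ' : 2 * h + 2 <= #|J| by case/orP: cJ => // /andP[/eqP h1 _]; rewrite h1 in h0.
split=> //.
- by rewrite subUset sub1set yX.
- exact: indepU1.
- by apply/orP; right; rewrite cy; slia.
- by rewrite cy; have -> : #|J|.+1 - 1 - h = #|J| - h by slia.
- move=> {cJ wJ} m u mh uJ dm.
  have [u0 u0I u0u] : exists2 u0, u0 \in J & (u \in J -> u0 = u).
    have [uI|uI] := boolP (u \in J); first by exists u.
    by have [u0] := prof_mem pJ; exists u0.
  have [|K [sK uK cK wK]] := smJ m u0 mh u0I.
    by move=> x xI; rewrite dm // inE xI orbT.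
  exists K; split=> //; first by apply: subset_trans sK (subsetUr _ _).
  by apply: contra uK => uK; rewrite u0u //; apply: (subsetP sK).
move=> _; have [|x [z [xJ zJ nxz dxz]]] := prJ; first slia.
by exists x, z; rewrite !inE xJ zJ !orbT.
Qed.

(* In a good set the value of a profile bounds the number of parts; in a low one some
   member of a profile has degree below the value. *)
Definition good X := exists J h, profile X J h /\ partitionable X (#|J| - h).
Definition lowP (c : nat) X := exists J h u, [/\ profile X J h, u \in J & dg X u + h + c <= #|J|].
Definition low X := lowP 1 X.

(** * Pieces hanging at a vertex *)

Lemma card_setD_lt X A : A \subset X -> A != set0 -> #|X :\: A| < #|X|.
Proof.
move=> sAX /set0Pn[a aA]; apply: proper_card; apply/properP; split; first exact: subsetDl.
by exists a; [apply: (subsetP sAX)|rewrite inE aA].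
Qed.

Lemma card_lt_sub X A : A \subset X -> X :\: A != set0 -> #|A| < #|X|.
Proof. by move=> sAX nA; rewrite proper_card // properE sAX -setD_eq0. Qed.

Lemma conn_comp_mem X x : x \in X -> exists K, [/\ x \in K, clo X K & conn K].
Proof.
have [n] := ubnP #|X|; elim: n X => // n IH X; rewrite ltnS => leX xX.
have [cX|/(connN)[A [cA A0 nA]]] := boolP (conn X).
  by exists X; split=> //; apply/cloP.
have [xA|xA] := boolP (x \in A).
  have [||K [xK cK cnK]] := IH A => //; last by exists K; split=> //; apply: clo_trans cA cK.
  exact: leq_trans (card_lt_sub (clo_sub cA) nA) leX.
have [||K [xK cK cnK]] := IH (X :\: A).
- exact: leq_trans (card_setD_lt (clo_sub cA) A0) leX.
- by rewrite inE xA.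
by exists K; split=> //; apply: clo_trans (cloC cA) cK.
Qed.

(** * Ears: completing a set to a 2-connected one *)

Section Ear.
(** F expresses that Q is attached to S firmly enough: the attachment survives the loss of a vertex
    of S and of the parts of Q without edges to S. It is used with two neighbours of a single
    vertex, and with two attachment vertices in a 2-connected S. *)
Variables (S : {set T}) (F : pred {set T}).
Hypotheses (cS : conn S) (cSs : forall s, s \in S -> conn (S :\ s)).
Hypothesis F_card : forall Q, F Q -> [disjoint S & Q] -> 2 < #|S :|: Q|.
Hypothesis F_edge : forall Q, F Q -> exists x y, [/\ x \in S, y \in Q & e x y].
Hypothesis F_edge2 : forall Q s, F Q -> s \in S ->
  S :\ s = set0 \/ exists x y, [/\ x \in S :\ s, y \in Q & e x y].
Hypothesis F_rem : forall Q K, F Q -> K \subset Q -> noedge S K -> F (Q :\: K).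

(* A minimal connected set attached to S can be absorbed into S: a piece that
   a vertex deletion cuts off from S could be dropped. *)
Lemma ear Q : [disjoint S & Q] -> conn Q -> F Q ->
  exists Q', [/\ Q' \subset Q, Q' != set0 & two_conn (S :|: Q')].
Proof.
have [n] := ubnP #|Q|; elim: n Q => // n IH Q; rewrite ltnS => leQ dSQ cQ FQ.
have [tSQ|] := boolP (two_conn (S :|: Q)).
  exists Q; split=> //; have [x [y [_ yQ _]]] := F_edge FQ.
  by apply/set0Pn; exists y.
have cSQ : conn (S :|: Q).
  by have [x [y [xS yQ exy]]] := F_edge FQ; apply: conn_link xS yQ exy.
rewrite /two_conn F_card // cSQ /= => /forall_inPn[s]; rewrite inE => /orP[sS|sQ] nc.
  case/negP: nc.
  have EsQ : (S :|: Q) :\ s = (S :\ s) :|: Q.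
    by rewrite setDUl; congr (_ :|: _); apply/setDidPl; rewrite disjoint_sym disjoints1 (disjointFr dSQ).
  rewrite EsQ; have [->|[x [y [xS yQ exy]]]] := F_edge2 FQ sS; first by rewrite set0U.
  exact: conn_link (cSs sS) cQ xS yQ exy.
have sS : s \notin S by rewrite (disjointFl dSQ).
have sSsQ : S \subset (S :|: Q) :\ s.
  by apply/subsetP=> x xS; rewrite !inE xS andbT; apply: contraTneq xS => ->.
(* As s lies outside S, the set S stays connected after deleting s, so one side of the separation
   misses S. *)
have [K [cK K0 KS]] : exists K, [/\ clo ((S :|: Q) :\ s) K, K != set0 & [disjoint S & K]].
  have [A [cA A0 nA]] := connN nc.
  have [E|AS] := eqVneq (A :&: S) set0.
    by exists A; split=> //; rewrite disjoint_sym -setI_eq0 E.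
  exists (((S :|: Q) :\ s) :\: A); split=> //; first exact: cloC.
  rewrite -setI_eq0 setIDA -(connE cS (clo_cap sSsQ cA) AS) -subset0.
  by apply/subsetP=> x; rewrite !inE => /andP[/negbTE->].
have sKQ : K \subset Q :\ s.
  apply/subsetP=> x xK; have := subsetP (clo_sub cK) x xK; rewrite !inE.
  by rewrite (disjointFl KS xK) /=.
have sKQ' : K \subset Q := subset_trans sKQ (subsetDl _ _).
have nSK : noedge S K.
  move=> x y xS yK; apply/negP=> exy; have := disjointFr KS xS.
  by rewrite (clo_memr cK yK (subsetP sSsQ _ xS) exy).
have [||||Q' [sQ' Q'0 tQ']] := IH (Q :\: K).
- exact: leq_trans (card_setD_lt sKQ' K0) leQ.
- by apply: disjointWr dSQ; apply: subsetDl.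
- apply: (conn_rem cQ sQ); apply: (clo_subset _ sKQ cK).
  by apply: setSD; apply: subsetUr.
- exact: F_rem.
by exists Q'; split=> //; apply: subset_trans sQ' (subsetDl _ _).
Qed.
End Ear.

Lemma cycle_through r Q : r \notin Q -> conn Q -> 1 < dg Q r ->
  exists R, [/\ two_conn R, r \in R & R \subset r |: Q].
Proof.
move=> rQ cQ dQ.
have [|||||||||Q' [sQ' _ tQ']] := @ear [set r] [pred Q | 1 < dg Q r] _ _ _ _ _ _ Q.
- exact: conn1.
- move=> s; rewrite inE => /eqP->; rewrite setDv; exact: conn0.
- move=> Q1 /= dQ1 dis; rewrite card_disjU // cards1 add1n ltnS.
  by apply: leq_trans dQ1 _; apply: dg_le_card.
- move=> Q1 /= dQ1; have [|y yQ ery] := @dg_gt0 Q1 r; first by apply: leq_trans dQ1.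
  by exists r, y; rewrite inE eqxx.
- by move=> Q1 s _; rewrite inE => /eqP->; rewrite setDv; left.
- move=> Q1 K /= dQ1 sK nK; apply: leq_trans dQ1 _; apply: subset_leq_card.
  apply/subsetP=> y; rewrite !inE => /andP[yQ ery]; rewrite yQ ery !andbT.
  by apply/negP=> yK; have := nK r y; rewrite inE eqxx ery => /(_ isT yK).
- by rewrite disjoints1.
- by [].
- by [].
- by exists ([set r] :|: Q'); rewrite !inE eqxx; split=> //; apply: setUS.
Qed.

(** Two attachment vertices in R leave at least one after any deletion, which is what [ear] needs.
    Consequently a component outside a maximal R touches it in at most one vertex. *)
Lemma absorb_ear R Q p p' x x' : two_conn R -> conn Q -> [disjoint R & Q] ->
  p \in R -> p' \in R -> p != p' -> x \in Q -> x' \in Q -> e p x -> e p' x' ->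
  exists R', [/\ two_conn R', R \subset R', R' \subset R :|: Q & R' != R].
Proof.
move=> /two_connP[cR2 cR cRs] cQ dRQ pR p'R npp xQ x'Q epx epx'.
pose N Q := [set p in R | [exists x in Q, e p x]].
have [|||||||||Q' [sQ' Q'0 tQ']] := @ear R [pred Q | 1 < #|N Q|] _ _ _ _ _ _ Q.
- by [].
- by [].
- by move=> Q1 _ _; apply: leq_trans cR2 (subset_leq_card (subsetUl _ _)).
- move=> Q1 /= /ltnW; rewrite card_gt0 => /set0Pn[a]; rewrite inE => /andP[aR /exists_inP[b bQ eab]].
  by exists a, b.
- move=> Q1 s /= /card_gt1P[a [b [aN bN nab]]] sR; right.
  have [c [cN cs]] : exists c, c \in N Q1 /\ c != s.
    by have [E|?] := eqVneq a s; [exists b; rewrite -E eq_sym|exists a].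
  move: cN; rewrite inE => /andP[cR' /exists_inP[d dQ ecd]].
  by exists c, d; rewrite !inE cs.
- move=> Q1 K /= cN sK nK; apply: leq_trans cN _; apply: subset_leq_card.
  apply/subsetP=> a; rewrite !inE => /andP[aR /exists_inP[b bQ eab]]; rewrite aR.
  apply/exists_inP; exists b => //; rewrite inE bQ andbT.
  by apply/negP=> bK; have := nK a b aR bK; rewrite eab.
- by [].
- by [].
- apply/card_gt1P; exists p, p'; rewrite !inE pR p'R npp; split=> //; apply/exists_inP.
    by exists x.
  by exists x'.
exists (R :|: Q'); split=> //; first exact: subsetUl.
  exact: setUS.
apply: contraNneq Q'0 => E; have [Q0//|] := eqVneq Q' set0 => /set0Pn[a aQ].
have := subsetP (subsetUr R Q') a aQ; rewrite E => aR.
by have := disjointFr dRQ aR; rewrite (subsetP sQ' _ aQ).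
Qed.

(* U is a piece of a graph hanging at z. The set J pays for a partition of the piece
   together with z, of the piece alone, or of both; when only the piece alone is
   partitioned, z can still be added to J. *)
Definition free_or_joined U z := exists J, [/\ J \subset U, indep J, partitionable U #|J|,
  partitionable (z |: U) #|J| & wt (z |: U) J <= #|U|].
Definition joined U z := exists J, [/\ J \subset U, indep J,
  partitionable (z |: U) #|J| & wt (z |: U) J <= #|U|].
Definition detached U z := exists J, [/\ J \subset U, indep J, partitionable U #|J|,
  forall x, x \in J -> ~~ e z x & wt U J + dg U z <= #|U| /\ dg U z <= #|J|].
Definition flexible U z := free_or_joined U z \/ detached U z.

Lemma wt_mono X Y J : X \subset Y -> wt X J <= wt Y J.
Proof. by move=> sXY; apply: leq_sum => x _; apply: dgS. Qed.

Lemma dg_noedge A x : (forall y, y \in A -> ~~ e x y) -> dg A x = 0.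
Proof.
move=> H; apply/eqP; rewrite cards_eq0; apply/set0Pn=> -[y]; rewrite inE => /andP[/H].
by move/negP.
Qed.

Lemma dgUE A B x : [disjoint A & B] -> dg (A :|: B) x = dg A x + dg B x.
Proof.
move=> dAB; rewrite /dg -card_disjU.
  by apply: eq_card => y; rewrite !inE andb_orl.
by apply: disjointW dAB; apply/subsetP=> y; rewrite inE => /andP[].
Qed.

Lemma dgU1E z A x : z \notin A -> dg (z |: A) x = e x z + dg A x.
Proof. by move=> zA; rewrite dgUE ?disjoints1 // dg1. Qed.

Lemma wt_local X r U J : clo (X :\ r) U -> r \in X -> J \subset U -> wt X J = wt (r |: U) J.
Proof.
move=> cU rX sJ; apply: wt_eq => x /(subsetP sJ) xU.
apply/eqP; rewrite eqn_leq; apply/andP; split.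
  apply: subset_leq_card; apply/subsetP=> y; rewrite !inE => /andP[yX exy].
  rewrite exy andbT; have [//|yr] := eqVneq y r; apply: clo_mem cU xU _ exy.
  by rewrite !inE yr.
apply: dgS; rewrite subUset sub1set rX; apply: subset_trans (clo_sub cU) (subsetDl _ _).
Qed.

Lemma clo_notin X r U : clo (X :\ r) U -> r \notin U.
Proof. by move=> /clo_sub sU; apply/negP=> /(subsetP sU); rewrite !inE eqxx. Qed.

Lemma clo_D1 X r U : clo (X :\ r) U -> U \subset X.
Proof. by move=> /clo_sub sU; apply: subset_trans sU (subsetDl _ _). Qed.

Lemma disjUl A B C : [disjoint A & C] -> [disjoint B & C] -> [disjoint A :|: B & C].
Proof. by rewrite -!setI_eq0 setIUl => /eqP-> /eqP->; rewrite setU0. Qed.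

Lemma disjUr A B C : [disjoint C & A] -> [disjoint C & B] -> [disjoint C & A :|: B].
Proof. by rewrite ![[disjoint C & _]]disjoint_sym; apply: disjUl. Qed.

(** If one piece can take z along, it does, and the other is partitioned on its own. Two detached
    pieces simply add up, since the degree of z does. *)
Lemma flexibleU U V z : z \notin U -> z \notin V -> [disjoint U & V] -> noedge U V ->
  flexible U z -> flexible V z -> flexible (U :|: V) z.
Proof.
move=> zU zV dUV nUV.
have dz : dg (U :|: V) z = dg U z + dg V z by rewrite dgUE.
have EU I : I \subset U -> wt (U :|: V) I = wt U I.
  by move=> sI; apply: wt_eq => x /(subsetP sI); apply: dg_noedgel.
have EV I : I \subset V -> wt (U :|: V) I = wt V I.
  by move=> sI; apply: wt_eq => x /(subsetP sI); apply: dg_noedger.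
have EzU I : I \subset U -> wt (z |: (U :|: V)) I = wt (z |: U) I.
  move=> sI; apply: wt_eq => x /(subsetP sI) xU.
  by rewrite !dgU1E ?inE ?negb_or ?zU // dg_noedgel.
have EzV I : I \subset V -> wt (z |: (U :|: V)) I = wt (z |: V) I.
  move=> sI; apply: wt_eq => x /(subsetP sI) xU.
  by rewrite !dgU1E ?inE ?negb_or ?zU // dg_noedger.
have main (W W' I J : {set T}) : [disjoint W & W'] -> noedge W W' -> I \subset W -> J \subset W' ->
    indep I -> indep J -> [/\ I :|: J \subset W :|: W', indep (I :|: J), [disjoint I & J]
     & #|I :|: J| = #|I| + #|J|].
  move=> dW nW sI sJ iI iJ; have dIJ : [disjoint I & J] by apply: disjointW dW.
  split; [exact: setUSS| |by []|exact: card_disjU].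
  by apply: indepU => //; apply: noedgeS nW.
have nz (W I : {set T}) : (forall x, x \in I -> ~~ e z x) -> wt (z |: W) I <= wt W I.
  by move=> H; apply: leq_sum => x xI; apply: dgU1n; rewrite e_sym H.
move=> [[I [sI iI PI PzI wI]]|[I [sI iI PI nI [wI eI]]]] [[J [sJ iJ PJ PzJ wJ]]|[J [sJ iJ PJ nJ [wJ eJ]]]];
  have [sIJ iIJ dIJ cIJ] := main _ _ _ _ dUV nUV sI sJ iI iJ.
- left; exists (I :|: J); rewrite wtU // EzU // EzV // cIJ (card_disjU dUV) partitionableU //; split=> //.
    by rewrite setUA; apply: partitionableU => //; apply: disjUl; rewrite ?disjoints1.
  exact: leq_add.
- left; exists (I :|: J); rewrite wtU // EzU // EzV // cIJ (card_disjU dUV) partitionableU //; split=> //.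
    by rewrite setUA; apply: partitionableU => //; apply: disjUl; rewrite ?disjoints1.
  apply: leq_add => //; apply: leq_trans (nz _ _ nJ) _; slia.
- left; exists (I :|: J); rewrite wtU // EzU // EzV // cIJ (card_disjU dUV) partitionableU //; split=> //.
    rewrite setUCA; apply: partitionableU => //; apply: disjUr => //.
    by rewrite disjoint_sym disjoints1.
  apply: leq_add => //; apply: leq_trans (nz _ _ nI) _; slia.
right; exists (I :|: J); rewrite wtU // EU // EV // cIJ (card_disjU dUV) partitionableU //; split=> //.
  by move=> x; rewrite inE => /orP[/nI|/nJ].
rewrite dz; split; slia.
Qed.

Definition hang X r Z := [/\ r \in X, Z != set0, clo (X :\ r) Z & conn Z].

Lemma dg_out X r Z v : clo (X :\ r) Z -> v \in X -> v \notin Z -> v != r ->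
  dg X v + #|Z| < #|X|.
Proof.
move=> cZ vX vZ vr; have sZ := clo_D1 cZ.
have -> : #|X| = #|X :\: Z| + #|Z| by rewrite cardsD (setIidPr sZ) subnK // subset_leq_card.
rewrite -addSn leq_add2r (cardsD1 v) inE vZ vX add1n ltnS; apply: dg_le_card => y yX evy.
rewrite !inE yX andbT; apply/andP; split.
  by apply: contraTneq evy => ->; rewrite e_irr.
by apply: contra vZ => yZ; apply: (clo_memr cZ yZ) evy; rewrite !inE vr.
Qed.

Lemma sum_edge J r : \sum_(x in J) e x r = dg J r.
Proof.
rewrite /dg -sum1_card big_mkcond [RHS]big_mkcond; apply: eq_bigr => x _.
by rewrite inE e_sym; case: (x \in J); case: (e r x).
Qed.

Lemma wt_hang Z r J : J \subset Z -> wt (r |: Z) J <= wt Z J + dg Z r.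
Proof.
move=> sJ; apply: (@leq_trans (wt Z J + dg J r)).
  by rewrite -sum_edge -big_split; apply: leq_sum => x _; apply: dgU1.
by rewrite leq_add2l; apply: dgS.
Qed.

(** Adding v makes up for the possible edge from y to r. The degree of v is below #|X| - #|Z| and J
    receives at most one edge from r altogether, so the weight stays below #|X|. *)
Lemma bridge_low X r Z J y v : r \in X -> clo (X :\ r) Z -> dg Z r <= 1 ->
  J \subset Z -> indep J -> y \in J -> dg Z y < #|J| -> wt Z J < #|Z| ->
  v \in X -> v \notin Z -> v != r -> low X.
Proof.
move=> rX cZ d1 sJ iJ yJ dy wJ vX vZ vr.
have vJ : v \notin J by apply: contra vZ; apply: (subsetP sJ).
have cvJ : #|v |: J| = #|J|.+1 by rewrite cardsU1 vJ.
exists (v |: J), 0, y; split; last 1 first.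
- rewrite cvJ addn0 addn1 ltnS; apply: leq_trans dy.
  by rewrite -addn1 (leq_trans (dgD1_clo rX cZ (subsetP sJ _ yJ))) // leq_add2l leq_b1.
- apply: profile0; rewrite ?cvJ //.
  + by rewrite subUset sub1set vX (subset_trans sJ) // (clo_D1 cZ).
  + apply: indepU1 => // x xJ; apply: contra vZ => evx.
    by apply: (clo_memr cZ (subsetP sJ _ xJ)) evx; rewrite !inE vr.
  rewrite wtU1 // (wt_local cZ) //; have := wt_hang r sJ; have := dg_out cZ vX vZ vr; slia.
by rewrite inE yJ orbT.
Qed.

(** * Pieces attached along a 2-connected set *)

Section Gather.
Variables (G R V : {set T}) (U : T -> {set T}) (Q0 : {set T}).
Hypotheses (sRG : R \subset G) (sVG : V \subset G) (dVR : [disjoint V & R]).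
Hypothesis sQR : Q0 \subset R.
Hypothesis U_V : forall z, U z \subset V.
Hypothesis U_clo : forall z, z \in Q0 -> clo (G :\ z) (U z).
Hypothesis U_dis : forall z z', z \in Q0 -> z' \in Q0 -> z != z' -> [disjoint U z & U z'].
Hypothesis U_flexible : forall z, z \in Q0 -> flexible (U z) z.

Lemma piece_edge z p x : z \in Q0 -> p \in R -> p != z -> x \in U z -> ~~ e p x.
Proof.
move=> zQ pR pz xU; apply/negP=> epx.
have /(subsetP (U_V z)) pV : p \in U z.
  by apply: (clo_memr (U_clo zQ) xU _ epx); rewrite !inE pz (subsetP sRG).
by rewrite (disjointFl dVR pR) in pV.
Qed.

Lemma gather_pieces Q : Q \subset Q0 -> let W := \bigcup_(z in Q) U z in
  exists J, [/\ J \subset W, indep J, partitionable W #|J|, wt G J <= #|W| &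
    (partitionable (Q :|: W) #|J| /\ #|Q| <= #|J|) \/
    exists z0, [/\ z0 \in Q, forall x, x \in J -> ~~ e z0 x & wt G J + dg W z0 <= #|W|]].
Proof.
have [n] := ubnP #|Q|; elim: n Q => // n IH Q; rewrite ltnS => leQ sQ /=.
have [->|/set0Pn[z zQ]] := eqVneq Q set0.
  exists set0; rewrite big_set0 sub0set /wt big_set0 cards0 setU0 partitionable0; split=> //.
    by apply/indepP=> x y; rewrite inE.
  by left.
have zQ0 : z \in Q0 := subsetP sQ _ zQ; have zR : z \in R := subsetP sQR _ zQ0.
have zG : z \in G := subsetP sRG _ zR.
have sQ' : Q :\ z \subset Q0 by apply: subset_trans sQ; apply: subsetDl.
have [|J2 [sJ2 iJ2 P2 w2 alt]] := IH (Q :\ z) _ sQ'.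
  by move: leQ; rewrite (cardsD1 z Q) zQ.
rewrite (big_setD1 z zQ) /=.
move: sJ2 P2 w2 alt.
have zW x : x \in \bigcup_(i in Q :\ z) U i -> ~~ e z x.
  case/bigcupP=> i; rewrite !inE => /andP[iz iQ] xU.
  by apply: piece_edge xU; rewrite ?(subsetP sQ) // eq_sym.
have sWV : \bigcup_(i in Q :\ z) U i \subset V by apply/bigcupsP=> i _.
have dUW : [disjoint U z & \bigcup_(i in Q :\ z) U i].
  apply/bigcup_disjointP => i; rewrite !inE => /andP[iz iQ].
  by apply: U_dis; rewrite ?(subsetP sQ) // eq_sym.
move: zW sWV dUW; set W := \bigcup_(i in Q :\ z) U i.
move=> zW sWV dUW sJ2 PW w2 alt.
have nUW : noedge (U z) W.
  move=> x y xU yW; apply/negP=> exy; have := disjointFl dUW yW.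
  rewrite (clo_mem (U_clo zQ0) xU _ exy) //; have yV := subsetP sWV _ yW.
  rewrite !inE (subsetP sVG) // andbT; apply: contraTneq yV => ->.
  by rewrite (disjointFl dVR zR).
have zU : z \notin U z := clo_notin (U_clo zQ0).
have wG J : J \subset U z -> wt G J = wt (z |: U z) J by move=> sJ; apply: wt_local (U_clo zQ0) _ _.
have nzU J : (forall x, x \in J -> ~~ e z x) -> wt (z |: U z) J <= wt (U z) J.
  by move=> H; apply: leq_sum => x xI; apply: dgU1n; rewrite e_sym H.
have [J1 [sJ1 iJ1 P1 w1 alt1]] : exists J1, [/\ J1 \subset U z, indep J1, partitionable (U z) #|J1|,
    wt G J1 <= #|U z| & partitionable (z |: U z) #|J1| \/
    (forall x, x \in J1 -> ~~ e z x) /\ wt G J1 + dg (U z) z <= #|U z|].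
  have [[J1 [sJ1 iJ1 P1 Pz w1]]|[J1 [sJ1 iJ1 P1 nz [w1 d1]]]] := U_flexible zQ0.
    by exists J1; split; rewrite ?wG //; left.
  have w1' : wt G J1 + dg (U z) z <= #|U z|.
    by rewrite wG // (leq_trans _ w1) // leq_add2r nzU.
  by exists J1; split=> //; [apply: leq_trans w1'; apply: leq_addr|right].
have dJ : [disjoint J1 & J2] by apply: disjointW dUW.
have dgW p : dg (U z :|: W) p = dg (U z) p + dg W p by rewrite dgUE.
exists (J1 :|: J2); rewrite (card_disjU dJ) (card_disjU dUW) wtU //; split.
- exact: setUSS.
- by apply: indepU => //; apply: noedgeS nUW.
- exact: partitionableU.
- exact: leq_add.
case: alt => [[PQW cQ]|[z0 [z0Q nz0 w0]]]; last first.
  move: z0Q; rewrite !inE => /andP[z0z z0Q].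
  have z0R : z0 \in R by apply: (subsetP sQR); apply: (subsetP sQ).
  have nU x : x \in U z -> ~~ e z0 x by apply: piece_edge.
  right; exists z0; split=> //.
    by move=> x; rewrite inE => /orP[/(subsetP sJ1)/nU|/nz0].
  by rewrite dgW dg_noedge // add0n -addnA leq_add.
case: alt1 => [Pz|[nz w1']].
  left; split; last first.
    rewrite (cardsD1 z Q) zQ leq_add //; apply: partitionable_gt0 Pz.
    by apply/set0Pn; exists z; rewrite !inE eqxx.
  have -> : Q :|: (U z :|: W) = (z |: U z) :|: (Q :\ z :|: W).
    by apply/setP=> x; rewrite !inE; case: eqP => [->|_] //=; rewrite ?zQ // orbCA.
  apply: partitionableU => //; apply: disjUl; first rewrite disjoints1 !inE eqxx /=.
    by apply/negP=> /(subsetP sWV) zV; rewrite (disjointFr dVR zV) in zR.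
  apply: disjUr => //; apply: disjointW dVR; first exact: U_V.
  by apply: subset_trans (subsetDl _ _) (subset_trans sQ sQR).
right; exists z; split=> //.
  by move=> x; rewrite inE => /orP[/nz|/(subsetP sJ2)/zW].
by rewrite dgW [dg W z]dg_noedge // addn0 addnAC leq_add.
Qed.
End Gather.

Section Phi.
Variable X : {set T}.
Hypotheses (cX : conn X) (dX : forall x, x \in X -> 1 < dg X x).

Lemma conn_closed_D1 r Z : r \in X -> clo (X :\ r) Z -> Z != set0 -> 0 < dg Z r.
Proof.
move=> rX cZ Z0; rewrite lt0n; apply/negP=> /eqP dZ.
have rZ := clo_notin cZ; case/negP: rZ.
suff -> : Z = X by [].
apply: (connE cX) => //; apply/cloP; split=> [|x y xZ yX exy]; first exact: clo_D1 cZ.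
apply: (clo_mem cZ xZ _ exy); rewrite !inE yX andbT.
apply: contraPneq dZ => yr; rewrite yr e_sym in exy.
by apply/eqP; rewrite -lt0n; apply: edge_dg_gt0 exy.
Qed.

(* No proper piece inside Z needs its attachment vertex in order to be partitioned. *)
Definition safe Z := forall z K k, z \in Z -> K \proper Z -> hang X z K ->
  partitionable (z |: K) k -> partitionable K k.

(** U is split into components of X - z. These are proper subsets of Z, so safety of Z upgrades
    [joined] to [free_or_joined]. *)
Lemma pieces_flexible Z U z :
  (forall K r, #|K| < #|Z| -> hang X r K -> safe K -> [\/ joined K r, detached K r | low X]) ->
  safe Z -> z \in Z -> Z \subset X -> U \subset Z -> clo (X :\ z) U -> flexible U z \/ low X.
Proof.
move=> IHZ sfZ zZ sZX; have [n] := ubnP #|U|.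
elim: n U => // n IH U; rewrite ltnS => leU sUZ cU; have zU := clo_notin cU.
have [->|U0] := eqVneq U set0.
  left; right; exists set0; rewrite sub0set cards0 partitionable0 /wt big_set0.
  split=> //; [by apply/indepP=> x y; rewrite inE|by move=> x; rewrite inE|].
  by rewrite dg_noedge // => y; rewrite inE.
have [K [sKU K0 cK cnK]] := conn_comp cU U0.
have zX : z \in X := subsetP sZX _ zZ.
have sKZ : K \proper Z.
  apply/properP; split; first exact: subset_trans sUZ.
  by exists z => //; apply: clo_notin cK.
have hK : hang X z K by [].
have cUK : clo (X :\ z) (U :\: K).
  apply/cloP; split=> [|x y].
    by apply: subset_trans (clo_sub cU); apply: subsetDl.
  rewrite !inE => /andP[xK xU] /andP[yz yX] exy.
  have yXz : y \in X :\ z by rewrite !inE yz.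
  rewrite (clo_mem cU xU yXz exy) andbT; apply: contra xK => yK.
  by apply: (clo_memr cK yK) exy; apply: (subsetP (clo_sub cU)).
have sfK : safe K.
  move=> a L k aK sL; apply: (sfZ a) => //.
    by apply: (subsetP (proper_sub sKZ)).
  exact: proper_trans sL sKZ.
have [|||lX] := IH _ _ _ cUK; last by right.
- exact: leq_trans (card_setD_lt sKU K0) leU.
- by apply: subset_trans sUZ; apply: subsetDl.
move=> gU; have EU : U = K :|: (U :\: K) by rewrite -{1}(setID U K) (setIidPr sKU).
have dK : [disjoint K & U :\: K] by rewrite disjoint_sym disjoints_subset setDE subsetIr.
have nK : noedge K (U :\: K).
  exact: noedge_clo (clo_subset (clo_sub cU) sKU cK).
have [gK|gK|lX] := IHZ K z (proper_card sKZ) hK sfK.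
- left; rewrite EU; apply: flexibleU => //; first exact: clo_notin cK.
    exact: clo_notin cUK.
  left; case: gK => J [sJ iJ PJ wJ]; exists J; split=> //.
  exact: (sfZ z) PJ.
- left; rewrite EU; apply: flexibleU => //; first exact: clo_notin cK.
    exact: clo_notin cUK.
  by right.
by right.
Qed.

Lemma hang_bridge Z r :
  (forall K s, #|K| < #|Z| -> hang X s K -> safe K -> [\/ joined K s, detached K s | low X]) ->
  hang X r Z -> safe Z -> dg Z r <= 1 -> [\/ joined Z r, detached Z r | low X].
Proof.
move=> IH hZ sfZ d1; case: (hZ) => rX Z0 cZ cnZ.
have sZX := clo_D1 cZ; have rZ := clo_notin cZ.
have d1' : dg Z r = 1 by apply/eqP; rewrite eqn_leq d1 (conn_closed_D1 rX cZ Z0).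
have [y yZ ery] : exists2 y, y \in Z & e r y by apply: dg_gt0; rewrite d1'.
have uy x : x \in Z -> e r x -> x = y.
  move=> xZ erx; apply/eqP; apply: contraTT d1 => nxy; rewrite -ltnNge.
  by apply/card_gt1P; exists x, y; rewrite !inE xZ yZ.
have yX := subsetP sZX _ yZ.
(* Since r meets Z only in y, what remains of Z hangs at y, and the pieces are now taken at y
   instead of r. *)
have cU : clo (X :\ y) (Z :\ y).
  apply/cloP; split=> [|a b]; first exact: setSD.
  rewrite !inE => /andP[ay aZ] /andP[by_ bX] eab; rewrite by_ /=.
  have [br|br] := eqVneq b r; last by apply: (clo_mem cZ aZ _ eab); rewrite !inE br.
  by case/eqP: ay; apply: uy; rewrite // e_sym -br.
have yU : y \notin Z :\ y by rewrite !inE eqxx.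
have EZ : y |: (Z :\ y) = Z by rewrite setD1K.
have cZ1 : #|Z| = #|Z :\ y|.+1 by rewrite (cardsD1 y) yZ.
have [] := pieces_flexible IH sfZ yZ sZX (subsetDl _ _) cU; last by constructor 3.
case=> [[J [sJ iJ PJ PZ wJ]]|[J [sJ iJ PJ nJ [wJ dJ]]]].
  rewrite EZ in PZ wJ; constructor 2; exists J; split=> //.
  - exact: subset_trans sJ (subsetDl _ _).
  - move=> x /(subsetP sJ); rewrite !inE => /andP[xy xZ].
    by apply: contraNN xy => /(uy x xZ)->.
  by rewrite d1' (partitionable_gt0 Z0 PZ) cZ1; slia.
constructor 3.
have yJ : y \notin J by apply: contra yU; apply: (subsetP sJ).
have dZy : dg Z y = dg (Z :\ y) y by rewrite -{1}EZ dgU1E // e_irr.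
have wZ : wt Z J <= wt (Z :\ y) J.
  rewrite -{1}EZ; apply: leq_sum => x xJ; apply: dgU1n; rewrite e_sym; exact: nJ.
have [v [vX vZ vr]] : exists v, [/\ v \in X, v \notin Z & v != r].
  have /card_gt1P[a [b [aN bN nab]]] := dX rX.
  move: aN bN; rewrite !inE => /andP[aX era] /andP[bX erb].
  have ra : a != r by apply: contraTneq era => ->; rewrite e_irr.
  have rb : b != r by apply: contraTneq erb => ->; rewrite e_irr.
  have [aZ|aZ] := boolP (a \in Z); last by exists a.
  have [bZ|bZ] := boolP (b \in Z); last by exists b.
  by rewrite (uy a) // (uy b) // eqxx in nab.
apply: (@bridge_low X r Z (y |: J) y v) => //.
- by rewrite subUset sub1set yZ (subset_trans sJ) // subsetDl.
- exact: indepU1.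
- by rewrite !inE eqxx.
- by rewrite dZy cardsU1 yJ.
- by rewrite wtU1 // dZy cZ1 ltnS (leq_trans _ wJ) // addnC leq_add2r.
Qed.

(** Let R be a maximal 2-connected set through r in Z + r. By [absorb_ear] each component of Z \ R
    is attached to one vertex of R, and this is not r because Z is connected. If gathering absorbs
    all of R - r, then Z is partitioned without r, whose neighbours in Z lie in R - r and number at
    most #|J|: [detached]. Otherwise R is a part paid for by z0: [joined]. *)
Lemma hang_cycle Z r :
  (forall K s, #|K| < #|Z| -> hang X s K -> safe K -> [\/ joined K s, detached K s | low X]) ->
  hang X r Z -> safe Z -> 1 < dg Z r -> [\/ joined Z r, detached Z r | low X].
Proof.
move=> IH hZ sfZ d2; case: (hZ) => rX Z0 cZ cnZ.
have sZX := clo_D1 cZ; have rZ := clo_notin cZ.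
have sGX : r |: Z \subset X by rewrite subUset sub1set rX.
have [R0 [tR0 rR0 sR0]] := cycle_through rZ cnZ d2.
have [R mR sR0R] := @maxset_exists T [pred R : {set T} | two_conn R && (R \subset r |: Z)] R0
   (introT andP (conj tR0 sR0)).
have /andP[tR sRG] : two_conn R && (R \subset r |: Z) := maxsetp mR.
have rR : r \in R := subsetP sR0R _ rR0.
pose V := Z :\: R.
have sVZ : V \subset Z by apply: subsetDl.
have dVR : [disjoint V & R] by rewrite disjoints_subset /V setDE subsetIr.
have EG : r |: Z = R :|: V.
  apply/setP=> x; rewrite !inE; case: (boolP (x \in R)) => xR /=.
    by have := subsetP sRG x xR; rewrite !inE.
  by case: eqP => // xr; rewrite xr rR in xR.
have clV K z x y : clo V K -> x \in K -> y \in X -> e x y -> y \in R \/ y \in K.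
  move=> cK xK yX exy; have xV := subsetP (clo_sub cK) x xK.
  have : y \in r |: Z.
    rewrite !inE; case: eqP => //= yr; apply: (clo_mem cZ (subsetP sVZ _ xV) _ exy).
    by rewrite !inE yX andbT; apply/eqP.
  by rewrite EG inE => /orP[|yV]; [left|right; apply: (clo_mem cK xK yV exy)].
have att x : x \in V -> exists z K, [/\ z \in R :\ r, x \in K, K \subset V & clo (X :\ z) K].
  move=> xV; have [K [xK cK cnK]] := conn_comp_mem xV.
  have sKV := clo_sub cK.
  have dRK : [disjoint R & K] by rewrite disjoint_sym; apply: disjointW dVR.
  have one p p' a a' : p \in R -> p' \in R -> a \in K -> a' \in K -> e a p -> e a' p' -> p = p'.
    move=> pR p'R aK a'K eap eap'; apply/eqP/negPn/negP=> npp.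
    rewrite e_sym in eap; rewrite e_sym in eap'.
    have [R' [tR' sR' sR'K nR']] := absorb_ear tR cnK dRK pR p'R npp aK a'K eap eap'.
    case/eqP: nR'; apply: (maxsetsup mR) => //=; rewrite tR' (subset_trans sR'K) //.
    by rewrite EG setUS.
  have [clX|] := boolP (clo X K).
    have EK : K = X by apply: (connE cX) => //; apply/set0Pn; exists x.
    by case/negP: rZ; rewrite (subsetP sVZ) // (subsetP sKV) // EK.
  rewrite /clo (subset_trans sKV (subset_trans sVZ sZX)) /=.
  case/forall_inPn=> a aK /forall_inPn[z zX]; rewrite negb_imply => /andP[eaz zK].
  have zR : z \in R by case: (clV K z a z cK aK zX eaz) => // zK'; rewrite zK' in zK.
  have cKz : clo (X :\ z) K.
    apply/cloP; split=> [|b c bK].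
      apply/subsetP=> b bK; rewrite !inE (subsetP sZX) ?(subsetP sVZ) ?(subsetP sKV) // andbT.
      by apply: contraNneq zK => <-.
    rewrite !inE => /andP[cz cX'] ebc.
    case: (clV K z b c cK bK cX' ebc) => // cR; case/eqP: cz; exact: one cR zR bK aK ebc eaz.
  (* A component attached to r alone would be closed in Z, hence equal to Z, leaving nothing but r
     for R. *)
  exists z, K; split=> //; rewrite !inE zR andbT; apply/eqP=> zr.
  have EK : K = Z.
    apply: (connE cnZ); last by apply/set0Pn; exists x.
    rewrite zr in cKz; exact: (clo_subset (clo_sub cZ) (subset_trans sKV sVZ) cKz).
  case/two_connP: tR => + _ _; rewrite ltnNge => /negP; case.
  suff sRr : R \subset [set r] by rewrite (leq_trans (subset_leq_card sRr)) // cards1.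
  apply/subsetP=> b bR; have := subsetP sRG _ bR; rewrite !inE => /orP[//|bZ].
  by have := disjointFl dVR bR; rewrite (subsetP sKV) // EK.
pose U z := \bigcup_(K : {set T} | (K \subset V) && clo (X :\ z) K) K.
have UV z : U z \subset V by apply/bigcupsP=> K /andP[].
have Ucl z : clo (X :\ z) (U z).
  apply/cloP; split=> [|a b /bigcupP[K /andP[sK cK] aK] bX eab].
    by apply/bigcupsP=> K /andP[_ /clo_sub].
  by apply/bigcupP; exists K; rewrite ?sK //; apply: (clo_mem cK aK bX eab).
have Udis z z' : z \in R :\ r -> z' \in R :\ r -> z != z' -> [disjoint U z & U z'].
  rewrite !inE => /andP[zr zR] /andP[z'r z'R] nzz.
  rewrite -setI_eq0; apply: contraT => /set0Pn[a]; rewrite inE => /andP[aU aU'].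
  (* Leaving both pieces at once would require a vertex equal to z and to z'. So the intersection is
     closed in X, and if nonempty it is X, although r is not in it. *)
  have clX : clo X (U z :&: U z').
    apply/cloP; split=> [|b c].
      by apply: subset_trans (subsetIl _ _) (subset_trans (UV z) (subset_trans sVZ sZX)).
    rewrite !inE => /andP[bU bU'] cX' ebc.
    have cz : c \in U z -> c \notin R.
      by move=> /(subsetP (UV z)) cV; rewrite (disjointFr dVR cV).
    have cz' : c \in U z' -> c \notin R.
      by move=> /(subsetP (UV z')) cV; rewrite (disjointFr dVR cV).
    have Hz : c != z -> c \in U z.
      by move=> ncz; apply: (clo_mem (Ucl z) bU _ ebc); rewrite !inE ncz.
    have Hz' : c != z' -> c \in U z'.
      by move=> ncz; apply: (clo_mem (Ucl z') bU' _ ebc); rewrite !inE ncz.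
    have [Ez|nz] := eqVneq c z; last have [Ez'|nz'] := eqVneq c z'.
    - by have := cz' (Hz' _); rewrite Ez zR => /(_ nzz).
    - by have := cz (Hz nz); rewrite Ez' z'R.
    by rewrite Hz ?Hz'.
  have EX : U z :&: U z' = X by apply: (connE cX) => //; apply/set0Pn; exists a; rewrite inE aU.
  by case/negP: rZ; rewrite (subsetP sVZ) // (subsetP (UV z)) //; have := rX; rewrite -EX inE => /andP[].
have EV : \bigcup_(z in R :\ r) U z = V.
  apply/eqP; rewrite eqEsubset; apply/andP; split; first by apply/bigcupsP=> z _.
  apply/subsetP=> x xV; have [z [K [zR xK sK cK]]] := att x xV.
  by apply/bigcupP; exists z => //; apply/bigcupP; exists K; rewrite ?sK.
have RrZ z : z \in R :\ r -> z \in Z.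
  by rewrite !inE => /andP[zr /(subsetP sRG)]; rewrite !inE (negbTE zr).
have [lX|nlX] := classic (low X); first by constructor 3.
have Ug z : z \in R :\ r -> flexible (U z) z.
  move=> zR; have zZ := RrZ z zR.
  by have [] := pieces_flexible IH sfZ zZ sZX (subset_trans (UV z) sVZ) (Ucl z).
have UclG z : z \in R :\ r -> clo ((r |: Z) :\ z) (U z).
  move=> zR; apply: (clo_subset _ _ (Ucl z)); first exact: setSD.
  apply/subsetP=> a aU; have := subsetP (UV z) a aU; rewrite !inE => /andP[aR aZ].
  rewrite aZ orbT andbT; apply: contraNneq aR => ->.
  by move: zR; rewrite !inE => /andP[].
have sVG : V \subset r |: Z by rewrite EG subsetUr.
have [J []] := gather_pieces sRG sVG dVR (subsetDl _ _) UV UclG Udis Ug (subxx _).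
rewrite EV => sJ iJ PV wJ alt.
have cZ1 : #|Z| = #|R :\ r| + #|V|.
  have : #|r |: Z| = #|R| + #|V| by rewrite EG card_disjU // disjoint_sym.
  by rewrite cardsU1 rZ (cardsD1 r R) rR; slia.
have RrV : [disjoint R :\ r & V].
  by rewrite disjoint_sym; apply: disjointWr dVR; apply: subsetDl.
have EZ : Z = (R :\ r) :|: V.
  apply/setP=> x; have := congr1 (fun A : {set T} => x \in A :\ r) EG.
  rewrite !inE; case: eqP => [->|_] //=; by rewrite (negbTE rZ) rR.
have nrV x : x \in V -> ~~ e r x.
  rewrite -EV => /bigcupP[z zR xU]; apply/negP=> erx.
  have : r \in U z.
    apply: (clo_memr (Ucl z) xU _ erx); rewrite !inE rX andbT eq_sym.
    by move: zR; rewrite !inE => /andP[].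
  by move/(subsetP (UV z)); rewrite (disjointFl dVR).
case: alt => [[PZ cR]|[z0 [z0R nz0 w0]]].
  constructor 2; exists J; split.
  - exact: subset_trans sJ sVZ.
  - by [].
  - by rewrite EZ.
  - by move=> x /(subsetP sJ)/nrV.
  have dr : dg Z r <= #|R :\ r|.
    apply: dg_le_card => y; rewrite {1}EZ inE => /orP[//|/nrV/negbTE->//].
  have : wt Z J <= wt (r |: Z) J by apply: wt_mono; apply: subsetUr.
  split; slia.
move: z0R; rewrite !inE => /andP[z0r z0R].
have z0J : z0 \notin J.
  by apply/negP=> /(subsetP sJ) z0V; rewrite (disjointFr dVR z0V) in z0R.
constructor 1; exists (z0 |: J); split.
- by rewrite subUset sub1set (subset_trans sJ sVZ) RrZ // !inE z0r.
- exact: indepU1.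
- by rewrite cardsU1 z0J EG; apply: partitionableU => //; [rewrite disjoint_sym|apply: partitionable1].
rewrite wtU1 // {1}EG dgUE 1?disjoint_sym //.
by have := dg_lt z0R; rewrite (cardsD1 r R) rR; slia.
Qed.

Theorem hang_alternative Z r : hang X r Z -> safe Z -> [\/ joined Z r, detached Z r | low X].
Proof.
have [n] := ubnP #|Z|; elim: n Z r => // n IH Z r; rewrite ltnS => leZ hZ sfZ.
have IH' K s : #|K| < #|Z| -> hang X s K -> safe K -> [\/ joined K s, detached K s | low X].
  by move=> ltK; apply: IH; apply: leq_trans leZ.
by have [d1|d2] := leqP (dg Z r) 1; [apply: hang_bridge|apply: hang_cycle].
Qed.

End Phi.

(** * Exceptional graphs *)

(** The borderline of [low]: a degree at most the value. All exceptional sets satisfy it. *)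
Definition crit X := lowP 0 X.

Lemma low_crit X : low X -> crit X.
Proof. by case=> J [h [u [pJ uJ d]]]; exists J, h, u; split=> //; rewrite addn0 ltnW // -addn1. Qed.

Record split_at X w A B : Prop := SplitAt {
  spl_eq : X = w |: (A :|: B);
  spl_w : w \notin A :|: B;
  spl_dis : [disjoint A & B];
  spl_no : noedge A B }.

Lemma split_atC X w A B : split_at X w A B -> split_at X w B A.
Proof.
case=> E nw d n; split; [by rewrite E [A :|: B]setUC|by rewrite setUC|by rewrite disjoint_sym|].
exact: noedge_sym.
Qed.

Lemma split_card X w A B : split_at X w A B -> #|X| = #|A| + #|B| + 1.
Proof. by case=> -> nw d n; rewrite cardsU1 nw card_disjU // addnC. Qed.

Lemma split_mem X w A B : split_at X w A B -> w \in X.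
Proof. by case=> -> _ _ _; rewrite !inE eqxx. Qed.

Lemma split_dg X w A B x : split_at X w A B -> x \in A -> dg X x = dg A x + e x w.
Proof.
case=> -> nw d n xA; rewrite dgU1E // addnC dg_noedgel //.
Qed.

Lemma split_of X w C : w \in X -> clo (X :\ w) C -> split_at X w C (X :\ w :\: C).
Proof.
move=> wX cC; have sC := clo_sub cC.
have EC : C :|: (X :\ w :\: C) = X :\ w by rewrite -{2}(setID (X :\ w) C) (setIidPr sC).
split; first by rewrite EC setD1K.
- by rewrite EC !inE eqxx.
- by rewrite disjoint_sym disjoints_subset setDE subsetIr.
exact: noedge_clo.
Qed.

Lemma join X w A B I J h k : split_at X w A B -> 1 < #|I| -> 1 < #|J| ->
  profile A I h -> profile B J k -> profile X (I :|: J) (maxn h k).+1.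
Proof.
move=> [-> nw d n] I1 J1 pI pJ; have [kh|hk] := leqP k h.
  by apply: profileU1 pI pJ.
rewrite [A :|: B]setUC [I :|: J]setUC.
apply: profileU1 (ltnW hk) J1 I1 pJ pI => //; [by rewrite setUC|by rewrite disjoint_sym|exact: noedge_sym].
Qed.

Lemma union X Y I J h k : [disjoint X & Y] -> noedge X Y ->
  profile X I h -> profile Y J k -> profile (X :|: Y) (I :|: J) (maxn h k).
Proof.
move=> d n pI pJ; have [kh|hk] := leqP k h.
  by apply: profileU pI pJ.
rewrite [X :|: Y]setUC [I :|: J]setUC.
apply: profileU (ltnW hk) pJ pI => //; [by rewrite disjoint_sym|exact: noedge_sym].
Qed.

Lemma prof_dis X w A B I J h k : split_at X w A B -> profile A I h -> profile B J k ->
  #|I :|: J| = #|I| + #|J|.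
Proof.
by case=> _ _ d _ [sI _ _ _ _ _] [sJ _ _ _ _ _]; rewrite card_disjU //; apply: disjointW d.
Qed.

(** Only the larger of h and k is kept, so the value of the union is at least the sum of both
    values. The other value being positive, a degree equal to the value on one side is below the
    value of the union. *)
Lemma disconnected_alt X Y : [disjoint X & Y] -> noedge X Y ->
  good X \/ crit X -> good Y \/ crit Y -> good (X :|: Y) \/ low (X :|: Y).
Proof.
move=> d n.
have cd (I J : {set T}) h k : profile X I h -> profile Y J k -> #|I :|: J| = #|I| + #|J|.
  by case=> sI _ _ _ _ _ [sJ _ _ _ _ _]; rewrite card_disjU //; apply: disjointW d.
case=> [[I [h [pI PI]]]|[I [h [u [pI uI du]]]]] [[J [k [pJ PJ]]]|[J [k [v [pJ vJ dv]]]]];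
  have pU := union d n pI pJ; have cU := cd _ _ _ _ pI pJ;
  have hI := prof_gt0 pI; have kJ := prof_gt0 pJ.
- left; exists (I :|: J), (maxn h k); split=> //; rewrite cU.
  by apply: partitionable_mono (partitionableU d PI PJ); slia.
- right; exists (I :|: J), (maxn h k), v; split; rewrite ?inE ?vJ ?orbT // cU.
  by rewrite dg_noedger // ?(subsetP (prof_sub pJ)) //; slia.
- right; exists (I :|: J), (maxn h k), u; split; rewrite ?inE ?uI // cU.
  by rewrite dg_noedgel // ?(subsetP (prof_sub pI)) //; slia.
right; exists (I :|: J), (maxn h k), u; split; rewrite ?inE ?uI // cU.
by rewrite dg_noedgel // ?(subsetP (prof_sub pI)) //; slia.
Qed.

(* The exceptional graphs: K2 (exc1), a graph with a hanging triangle (exc2), and two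
   of the latter joined at a further vertex (exc3). *)
Definition exc1 X := exists q q', [/\ q != q', e q q' & X = [set q; q']].

Record ear_exc X w q q' D : Prop := EarExc {
  ee_split : split_at X w [set q; q'] D;
  ee_neq : q != q';
  ee_qq : e q q';
  ee_wq : e w q;
  ee_wq' : e w q';
  ee_conn : conn X;
  ee_connD : conn D;
  ee_ntc : ~~ two_conn D;
  ee_card : 1 < #|D| }.

Definition exc2 X := exists w q q' D, ear_exc X w q q' D.
Definition exc3 X := exists w A B, [/\ split_at X w A B, conn X, exc2 A & exc2 B].

Lemma ear_excC X w q q' D : ear_exc X w q q' D -> ear_exc X w q' q D.
Proof.
case=> sp n qq wq wq' c cD tD c1; split=> //; first by rewrite setUC.
  by rewrite eq_sym.
by rewrite e_sym.
Qed.

Lemma ee_sum X w q q' D : ear_exc X w q q' D -> #|X| = #|D| + 3.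
Proof. by case=> /split_card-> n _ _ _ _ _ _ _; rewrite cards2 n; lia. Qed.

Lemma ee_dg X w q q' D : ear_exc X w q q' D -> dg X q = 2.
Proof.
case=> sp n qq wq wq' _ _ _ _; rewrite (split_dg sp) ?inE ?eqxx // e_sym wq.
by rewrite dgU1E ?inE // dg1 e_irr qq.
Qed.

Lemma ee_q X w q q' D : ear_exc X w q q' D -> q \in X.
Proof. by case=> -[-> _ _ _] *; rewrite !inE eqxx orbT. Qed.

Lemma ee_D X w q q' D : ear_exc X w q q' D -> D \subset X.
Proof. by case=> -[-> _ _ _] *; rewrite setUA subsetUr. Qed.

Lemma ee_qy X w q q' D y : ear_exc X w q q' D -> y \in D -> (q != y) && ~~ e q y.
Proof.
case=> -[_ _ d n] _ _ _ _ _ _ _ _ yD; rewrite n ?inE ?eqxx // andbT.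
by apply: contraTneq yD => <-; rewrite (disjointFr d) // !inE eqxx.
Qed.

Lemma ee_dgD X w q q' D y : ear_exc X w q q' D -> y \in D -> dg X y = dg D y + e y w.
Proof. by case=> /split_atC sp *; apply: split_dg sp _. Qed.

(** The degrees are 2 and at most #|D|, against #|X| = #|D| + 3. The freedom in y is used later to
    choose it away from the neighbours of a cut vertex. *)
Lemma ee_profile X w q q' D y : ear_exc X w q q' D -> y \in D -> profile X [set q; y] 0.
Proof.
move=> ee yD; have /andP[nqy nq] := ee_qy ee yD.
apply: profile0.
- by rewrite subUset !sub1set (ee_q ee) (subsetP (ee_D ee)).
- exact: indep2.
- by rewrite cards2.
rewrite wtU1 ?inE // wt1 (ee_dg ee) (ee_dgD ee) // (ee_sum ee).
by have := dg_lt yD; case: (e y w); slia.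
Qed.

Lemma exc2_crit X : exc2 X -> crit X.
Proof.
case=> w [q [q' [D ee]]]; have : 0 < #|D| by have := ee_card ee; slia.
rewrite card_gt0 => /set0Pn[y yD]; exists [set q; y], 0, q.
rewrite !inE eqxx (ee_dg ee) cards2; have [-> _] := andP (ee_qy ee yD).
by split=> //; apply: ee_profile ee yD.
Qed.

Lemma exc1_crit X : exc1 X -> crit X.
Proof.
case=> q [q' [n eqq ->]]; exists [set q], 0, q.
have dq : dg [set q; q'] q = 1 by rewrite dgU1E ?inE // dg1 e_irr eqq.
rewrite inE eqxx cards1 dq; split=> //; apply: profile0; rewrite ?cards1 ?indep1 //.
  by rewrite sub1set !inE eqxx.
by rewrite wt1 dq cards2 n.
Qed.

(* Deleting one vertex z from an exceptional graph can only separate part of D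
   from the triangle. *)
Lemma ee_cut X w q q' D z K : ear_exc X w q q' D -> z \in X -> clo (X :\ z) K ->
  K != set0 -> q \notin K -> q' \notin K ->
  K \subset D /\ (K = D \/ z \in D /\ clo (D :\ z) K).
Proof.
move=> ee zX cK K0 qK q'K; have [sp n eqq wq wq' cX cD _ _] := ee.
have [EX nw dQD nQD] := sp; have sDX := ee_D ee; have wX := split_mem sp.
have qX := ee_q ee; have q'X := ee_q (ear_excC ee).
have sK := clo_sub cK; have zK := clo_notin cK.
have wK : w \notin K.
  apply/negP=> wK; have [zq|zq] := eqVneq q z.
    have : q' \in K by apply: (clo_mem cK wK _ wq'); rewrite !inE q'X -zq eq_sym n.
    by apply/negP.
  have : q \in K by apply: (clo_mem cK wK _ wq); rewrite !inE qX zq.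
  by apply/negP.
have sKD : K \subset D.
  apply/subsetP=> x xK; have := subsetP sK x xK; rewrite EX !inE => /andP[_].
  case/orP=> [/eqP xw|]; first by rewrite -xw xK in wK.
  by case/orP=> // /orP[] /eqP xq; rewrite -xq xK in qK q'K.
split=> //; have [zD|zD] := boolP (z \in D); [right|left].
  by split=> //; apply: (clo_subset _ _ cK); [apply: setSD|rewrite subsetD1 sKD].
apply: (connE cD) => //; apply: (clo_subset _ sKD cK).
by rewrite subsetD1 sDX.
Qed.

(** Vertices on different sides A, B of a cut vertex have degree sum at most #|A| + #|B| < #|D|.
    Either z separates K from something, or K misses at most z and so contains one of a, b for any
    cut. *)
Lemma ntc_pair D K : conn D -> ~~ two_conn D -> 2 < #|D| -> K \subset D -> K != set0 ->
  K = D \/ (exists2 z, z \in D & clo (D :\ z) K) ->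
  exists y y', [/\ y \in K, y' \in D, y != y', ~~ e y y' & dg D y + dg D y' < #|D|].
Proof.
move=> cD tD D2 sKD K0 alt.
have pieces c A B : c \in D -> clo (D :\ c) A -> B = D :\ c :\: A ->
    forall y y', y \in A -> y' \in B -> [/\ y != y', ~~ e y y' & dg D y + dg D y' < #|D|].
  move=> cDc cA -> y y' yA y'B; have sp := split_of cDc cA.
  have y'A : y' \notin A by move: y'B; rewrite inE => /andP[].
  split; [by apply: contraNneq y'A => <-|exact: (spl_no sp)|].
  rewrite (split_card sp) (split_dg sp) // (split_dg (split_atC sp)) //.
  have := dg_lt yA; have := dg_lt y'B.
  by case: (e y c); case: (e y' c); slia.
have [c [A [cDc cA A0 B0]]] : exists c A, [/\ c \in D, clo (D :\ c) A, A != set0 & D :\ c :\: A != set0].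
  move: tD; rewrite /two_conn D2 cD /= => /forall_inPn[c cDc /connN[A [cA A0 nA]]].
  by exists c, A.
have [a aA] := set0Pn _ A0; have [b bB] := set0Pn _ B0.
have [nab eab dab] := pieces _ _ _ cDc cA erefl a b aA bB.
have aD : a \in D by apply: (subsetP (clo_D1 cA)).
have bD : b \in D by move: bB; rewrite !inE => /and3P[].
have use y y' : y \in K -> y' \in D -> y != y' -> ~~ e y y' -> dg D y + dg D y' < #|D| ->
    exists y y', [/\ y \in K, y' \in D, y != y', ~~ e y y' & dg D y + dg D y' < #|D|].
  by move=> *; exists y, y'.
case: alt => [EK|[z zD cK]]; first by apply: (use a b); rewrite ?EK.
have [E|R0] := eqVneq (D :\ z :\: K) set0.
  have inK x : x \in D -> x != z -> x \in K.
    move=> xD xz; apply: contraT => xK.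
    have : x \in D :\ z :\: K by rewrite !inE xK xz.
    by rewrite E inE.
  have [az|az] := eqVneq a z.
    have bz : b != z by rewrite -az eq_sym.
    by apply: (use b a); rewrite ?inK // 1?addnC // 1?eq_sym // e_sym.
  by apply: (use a b); rewrite ?inK.
have [y yK] := set0Pn _ K0; have [y' y'R] := set0Pn _ R0.
have [n ne d] := pieces _ _ _ zD cK erefl y y' yK y'R.
by apply: (use y y') => //; move: y'R; rewrite !inE => /and3P[].
Qed.

(** As A is connected, the vertex disconnecting w + A is some z in A, and K is a side that avoids
    w. *)
Lemma ntc_attach w A a : w \notin A -> conn A -> 1 < #|A| -> a \in A -> e w a ->
  ~~ two_conn (w |: A) -> exists z K, [/\ z \in A, clo (A :\ z) K, K != set0 & forall x, x \in K -> ~~ e x w].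
Proof.
move=> wA cA A1 aA ewa; have cW : conn (w |: A).
  by apply: (conn_link (conn1 w) cA (x := w) (y := a)); rewrite ?inE.
rewrite /two_conn cardsU1 wA add1n ltnS A1 cW /= => /forall_inPn[z zW nc].
have zw : z != w by apply: contraNneq nc => ->; rewrite setU1K.
have zA : z \in A by move: zW; rewrite !inE (negbTE zw).
have wWz : w \in (w |: A) :\ z by rewrite !inE eqxx andbT eq_sym.
have [K [cK K0 wK]] : exists K, [/\ clo ((w |: A) :\ z) K, K != set0 & w \notin K].
  have [S [cS S0 nS]] := connN nc; have [wS|wS] := boolP (w \in S); last by exists S.
  by exists ((w |: A) :\ z :\: S); split=> //; [apply: cloC|rewrite inE wS].
exists z, K; split=> //; last first.
  by move=> x xK; apply: contra wK => exw; apply: (clo_mem cK xK wWz exw).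
apply: (clo_subset _ _ cK); first by apply: setSD; apply: subsetUr.
apply/subsetP=> x xK; have := subsetP (clo_sub cK) x xK; rewrite !inE.
by case: eqP => // _; case: eqP => //= xw; rewrite -xw xK in wK.
Qed.

Lemma split_wt X w A B J : split_at X w A B -> J \subset A -> wt X J <= wt A J + #|J|.
Proof.
move=> sp sJ; rewrite -[#|J|]mul1n; apply: wt_le => x /(subsetP sJ) xA.
by rewrite (split_dg sp xA) leq_add2l leq_b1.
Qed.

Lemma split_partitionable X w A B k l : split_at X w A B -> partitionable (w |: A) k -> partitionable B l -> partitionable X (k + l).
Proof.
case=> -> nw d n PA PB; rewrite setUA; apply: partitionableU => //.
by apply: disjUl => //; rewrite disjoints1; apply: contra nw; rewrite inE => ->; rewrite orbT.
Qed.

(** The joined profile has four members, h = 1 and value 3. If q or q' is not adjacent to w, its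
    degree is 2. If w + A is 2-connected, X has 1 + 2 parts. Otherwise some K inside D has no edge
    to w and y is taken there: either y has degree at most 2, or a fifth member y' lifts the value
    to 4, against degree 3 of q. *)
Lemma ear_exc_alt X w A B w1 q q' D J : split_at X w A B -> ear_exc A w1 q q' D ->
  profile B J 0 -> #|J| = 2 -> partitionable B 2 -> good X \/ low X.
Proof.
move=> sp ee pJ J2 PB.
have spB := split_atC sp; have sJ := prof_sub pJ; have wJ := prof_wt pJ; rewrite mul0n addn0 in wJ.
have base u u' y : ear_exc A w1 u u' D -> y \in D ->
    profile X ([set u; y] :|: J) 1 /\ #|[set u; y] :|: J| = 4.
  move=> eu yD; have pu := ee_profile eu yD.
  have cu : #|[set u; y]| = 2 by rewrite cards2; case/andP: (ee_qy eu yD) => ->.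
  rewrite (prof_dis sp pu pJ) cu J2; split=> //.
  by apply: (join sp _ _ pu pJ); rewrite ?cu ?J2.
have [y0 y0D] : exists y, y \in D by apply/set0Pn; rewrite -card_gt0; have := ee_card ee; slia.
have adj u u' : ear_exc A w1 u u' D -> e u w \/ low X.
  move=> eu; have [uw|uw] := boolP (e u w); [by left|right].
  have [pb cb] := base _ _ _ eu y0D; exists ([set u; y0] :|: J), 1, u; rewrite cb !inE eqxx.
  by rewrite (split_dg sp (ee_q eu)) (ee_dg eu) (negbTE uw).
have [qw|] := adj _ _ ee; last by right.
have [q'w|] := adj _ _ (ear_excC ee); last by right.
have wA : w \notin A by apply: contra (spl_w sp); rewrite inE => ->.
have [tW|ntW] := boolP (two_conn (w |: A)).
  left; have [pb cb] := base _ _ _ ee y0D; exists ([set q; y0] :|: J), 1; rewrite cb.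
  by split=> //; apply: (split_partitionable sp (partitionable1 tW) PB).
have A1 : 1 < #|A| by rewrite (ee_sum ee); slia.
have [|z [K [zA cK K0 nK]]] := ntc_attach wA (ee_conn ee) A1 (ee_q ee) _ ntW; first by rewrite e_sym.
have qK : q \notin K by apply/negP=> /nK; rewrite qw.
have q'K : q' \notin K by apply/negP=> /nK; rewrite q'w.
have [sKD alt] := ee_cut ee zA cK K0 qK q'K.
have sDA := ee_D ee.
right; have [D2|D2] := leqP #|D| 2.
  have [y yK] := set0Pn _ K0; have yD := subsetP sKD y yK.
  have [pb cb] := base _ _ _ ee yD; exists ([set q; y] :|: J), 1, y.
  rewrite cb !inE eqxx orbT (split_dg sp (subsetP sDA _ yD)) (negbTE (nK y yK)).
  split=> //; rewrite (ee_dgD ee yD); have := dg_lt yD; case: (e y w1); slia.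
have [y [y' [yK y'D nyy eyy dyy]]] : exists y y', [/\ y \in K, y' \in D, y != y', ~~ e y y' & dg D y + dg D y' < #|D|].
  apply: (ntc_pair (ee_connD ee) (ee_ntc ee) D2 sKD K0).
  by case: alt => [|[zD cKD]]; [left|right; exists z].
have yD := subsetP sKD y yK; have [pb cb] := base _ _ _ ee yD.
have y'A := subsetP sDA _ y'D; have yA := subsetP sDA _ yD.
have /andP[nqy' eqy'] := ee_qy ee y'D; have /andP[nqy eqy] := ee_qy ee yD.
have AJ x : x \in J -> x \notin A by move=> /(subsetP sJ) xB; rewrite (disjointFl (spl_dis sp) xB).
have y'N : y' \notin [set q; y] :|: J.
  by rewrite !inE negb_or (eq_sym y' q) (eq_sym y' y) (negbTE nqy') (negbTE nyy) /=; apply: contraL y'A; apply: AJ.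
have dJ : [disjoint [set q; y] & J].
  by apply: disjUl; rewrite disjoints1; apply/negP=> /AJ; rewrite ?(ee_q ee) ?yA.
exists (y' |: ([set q; y] :|: J)), 1, q; split; last 1 first.
- rewrite cardsU1 y'N cb (split_dg sp (ee_q ee)) (ee_dg ee); case: (e q w); slia.
- apply: profile_add => //; first by rewrite (spl_eq sp) !inE y'A orbT.
    move=> x; rewrite !inE => /orP[/orP[]/eqP->|xJ]; rewrite 1?e_sym //.
    by apply: (noedge_sym (spl_no sp)) => //; apply: (subsetP sJ).
  rewrite cb wtU1 // wtU // wtU1 ?inE // wt1.
  rewrite (split_dg sp (ee_q ee)) (ee_dg ee) (split_dg sp y'A) (split_dg sp yA) (negbTE (nK y yK)).
  rewrite (ee_dgD ee yD) (ee_dgD ee y'D) (split_card sp) (ee_sum ee).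
  have := split_wt spB sJ; rewrite J2.
  by case: (e q w); case: (e y' w1); case: (e y' w); case: (e y w1); slia.
by rewrite !inE eqxx orbT.
Qed.

Lemma conn_disj_clo A K V : conn V -> V \subset A -> clo A K -> K :&: V != set0 -> V \subset K.
Proof.
by move=> cV sVA /(clo_cap sVA) cK K0; rewrite -(connE cV cK K0) subsetIl.
Qed.

Section Exc3.
Variables (X A B J : {set T}) (w : T).
Hypotheses (sp : split_at X w A B) (pJ : profile B J 0) (J2 : #|J| = 2).

Lemma exc3_base w1 A1 A2 w11 q1 q1' D1 w12 q2 q2' D2 y1 y2 :
  split_at A w1 A1 A2 -> ear_exc A1 w11 q1 q1' D1 -> ear_exc A2 w12 q2 q2' D2 ->
  y1 \in D1 -> y2 \in D2 ->
  [/\ profile A ([set q1; y1] :|: [set q2; y2]) 1,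
      #|[set q1; y1] :|: [set q2; y2]| = 4,
      profile X ([set q1; y1] :|: [set q2; y2] :|: J) 2 &
      #|[set q1; y1] :|: [set q2; y2] :|: J| = 6].
Proof.
move=> spA ee1 ee2 y1D y2D.
have p1 := ee_profile ee1 y1D; have p2 := ee_profile ee2 y2D.
have c1 : #|[set q1; y1]| = 2 by rewrite cards2; case/andP: (ee_qy ee1 y1D) => ->.
have c2 : #|[set q2; y2]| = 2 by rewrite cards2; case/andP: (ee_qy ee2 y2D) => ->.
have pA : profile A ([set q1; y1] :|: [set q2; y2]) 1.
  by apply: (join spA _ _ p1 p2); rewrite ?c1 ?c2.
have cA : #|[set q1; y1] :|: [set q2; y2]| = 4 by rewrite (prof_dis spA p1 p2) c1 c2.
split=> //; last by rewrite (prof_dis sp pA pJ) cA J2.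
by apply: (join sp _ _ pA pJ); rewrite ?cA ?J2.
Qed.

(** K cannot meet the connected set A2, which contains the neighbour q2 of w, and cannot contain w1,
    which has a neighbour in A2. So K lies in D1 and the argument of [ear_exc_alt] applies, with
    value 4, or 5 after adding y', where q1 has degree at most 4. *)
Lemma exc3_low w1 A1 A2 w11 q1 q1' D1 w12 q2 q2' D2 z K :
  conn A ->
  split_at A w1 A1 A2 -> ear_exc A1 w11 q1 q1' D1 -> ear_exc A2 w12 q2 q2' D2 ->
  e q1 w -> e q1' w -> e q2 w ->
  z \in A1 -> clo (A :\ z) K -> K != set0 -> (forall x, x \in K -> ~~ e x w) -> low X.
Proof.
move=> cA spA ee1 ee2 q1w q1'w q2w zA1 cK K0 nK.
have EA := spl_eq spA; have spA' := split_atC spA.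
have [y2 y2D] : exists y, y \in D2.
  by apply/set0Pn; rewrite -card_gt0; have := ee_card ee2; slia.
have sA1A : A1 \subset A by rewrite EA setUCA subsetUl.
have sA2A : A2 \subset A by rewrite EA setUA subsetUr.
have zA2 : z \notin A2 by rewrite (disjointFr (spl_dis spA) zA1).
have sA2z : A2 \subset A :\ z by rewrite subsetD1 sA2A.
have KA2 : K :&: A2 = set0.
  apply/eqP/negPn/negP=> /(conn_disj_clo (ee_conn ee2) sA2z cK) sK.
  by have := nK q2 (subsetP sK _ (ee_q ee2)); rewrite q2w.
have w1K : w1 \notin K.
  apply/negP=> w1K.
  have [||x [y [xA2 yA exy]]] := conn_edge cA sA2A.
  - by apply/set0Pn; exists q2; apply: ee_q ee2.
  - by apply/set0Pn; exists z; rewrite inE zA2 (subsetP sA1A).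
  have yw1 : y = w1.
    move: yA; rewrite EA !inE => /andP[yA2]; rewrite (negbTE yA2) orbF.
    case/orP=> [/eqP//|yA1]; have := spl_no spA yA1 xA2; by rewrite e_sym exy.
  have xK : x \in K.
    by apply: (clo_memr cK w1K (subsetP sA2z _ xA2)); rewrite -yw1.
  by have : x \in K :&: A2; [rewrite inE xK|rewrite KA2 inE].
have sKA1 : K \subset A1.
  apply/subsetP=> x xK; have := subsetP (clo_sub cK) x xK; rewrite EA !inE.
  case/andP=> _ /or3P[/eqP xw1|//|xA2]; first by rewrite -xw1 xK in w1K.
  by have : x \in K :&: A2; [rewrite inE xK|rewrite KA2 inE].
have cK1 : clo (A1 :\ z) K.
  by apply: (clo_subset _ _ cK); [apply: setSD|rewrite subsetD1 sKA1 (clo_notin cK)].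
have nK1 x : x \in K -> ~~ e x w1.
  move=> xK; apply: contra w1K => exw; apply: (clo_mem cK xK _ exw).
  rewrite !inE EA !inE eqxx andbT; apply: contraTneq zA1 => <-.
  by have := spl_w spA; rewrite inE negb_or => /andP[].
have qK : q1 \notin K by apply/negP=> /nK; rewrite q1w.
have q'K : q1' \notin K by apply/negP=> /nK; rewrite q1'w.
have [sKD alt] := ee_cut ee1 zA1 cK1 K0 qK q'K.
have sDA := ee_D ee1.
have [D2le|D2gt] := leqP #|D1| 2.
  have [y yK] := set0Pn _ K0; have yD := subsetP sKD y yK; have yA1 := subsetP sDA _ yD.
  have [_ _ pb cb] := exc3_base spA ee1 ee2 yD y2D.
  exists ([set q1; y] :|: [set q2; y2] :|: J), 2, y.
  rewrite cb !inE eqxx orbT (split_dg sp (subsetP sA1A _ yA1)) (negbTE (nK y yK)).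
  rewrite (split_dg spA yA1) (negbTE (nK1 y yK)).
  split=> //; rewrite (ee_dgD ee1 yD); have := dg_lt yD; case: (e y w11); slia.
have [y [y' [yK y'D nyy eyy dyy]]] : exists y y', [/\ y \in K, y' \in D1, y != y', ~~ e y y' & dg D1 y + dg D1 y' < #|D1|].
  apply: (ntc_pair (ee_connD ee1) (ee_ntc ee1) D2gt sKD K0).
  by case: alt => [|[zD cKD]]; [left|right; exists z].
have yD := subsetP sKD y yK; have [pA cA4 pb cb] := exc3_base spA ee1 ee2 yD y2D.
have y'A1 := subsetP sDA _ y'D; have yA1 := subsetP sDA _ yD; have q1A1 := ee_q ee1.
have y'A := subsetP sA1A _ y'A1; have yA := subsetP sA1A _ yA1; have q1A := subsetP sA1A _ q1A1.
have /andP[nqy' eqy'] := ee_qy ee1 y'D; have /andP[nqy eqy] := ee_qy ee1 yD.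
have p2 := ee_profile ee2 y2D; have s2 := prof_sub p2; have w2 := prof_wt p2.
have c2 : #|[set q2; y2]| = 2 by rewrite cards2; case/andP: (ee_qy ee2 y2D) => ->.
have s2A : [set q2; y2] \subset A := subset_trans s2 sA2A.
have sJ := prof_sub pJ; have wJ := prof_wt pJ; rewrite !mul0n !addn0 in wJ w2.
have n2 x : x \in A1 -> x \notin [set q2; y2].
  by move=> xA; apply: contraTN xA => /(subsetP s2) xA2; rewrite (disjointFl (spl_dis spA) xA2).
have nJ x : x \in A -> x \notin J.
  by move=> xA; apply: contraTN xA => /(subsetP sJ) xB; rewrite (disjointFl (spl_dis sp) xB).
have y'N : y' \notin [set q1; y] :|: [set q2; y2] :|: J.
  rewrite 2!in_setU (negbTE (n2 _ y'A1)) (negbTE (nJ _ y'A)) !inE (eq_sym y' q1) (eq_sym y' y).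
  by rewrite (negbTE nqy') (negbTE nyy).
have d1 : [disjoint [set q1; y] & [set q2; y2]].
  by apply: disjUl; rewrite disjoints1 n2.
have d2 : [disjoint [set q1; y] :|: [set q2; y2] & J].
  apply: disjointW (spl_dis sp) => //; rewrite subUset s2A andbT.
  by rewrite subUset !sub1set q1A.
exists (y' |: ([set q1; y] :|: [set q2; y2] :|: J)), 2, q1; split; last 1 first.
- rewrite cardsU1 y'N cb (split_dg sp q1A) (split_dg spA q1A1) (ee_dg ee1).
  by case: (e q1 w); case: (e q1 w1); slia.
- apply: profile_add => //; first by rewrite (spl_eq sp) !inE y'A orbT.
    move=> x; rewrite 2!in_setU => /orP[/orP[]|].
    + by rewrite !inE => /orP[]/eqP->; rewrite e_sym.
    + by move=> /(subsetP s2); apply: (spl_no spA).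
    by move=> /(subsetP sJ); apply: (spl_no sp).
  rewrite cb wtU1 // wtU // wtU // wtU1 ?inE // wt1.
  rewrite (split_dg sp q1A) (split_dg sp y'A) (split_dg sp yA) (negbTE (nK y yK)).
  rewrite (split_dg spA q1A1) (split_dg spA y'A1) (split_dg spA yA1) (negbTE (nK1 y yK)).
  rewrite (ee_dg ee1) (ee_dgD ee1 yD) (ee_dgD ee1 y'D).
  rewrite (split_card sp) (split_card spA) (ee_sum ee1).
  have := split_wt sp s2A; have := split_wt spA' s2; have := split_wt (split_atC sp) sJ.
  rewrite J2 c2; have := leq_b1 (e q1 w); have := leq_b1 (e q1 w1).
  have := leq_b1 (e y w11); have := leq_b1 (e y' w11); have := leq_b1 (e y' w1); have := leq_b1 (e y' w).
  slia.
by rewrite !inE eqxx orbT.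
Qed.

(** Here six members with h = 2 give value 4. The triangle tips have degree at most 3 unless
    adjacent to w, and if w + A is 2-connected three parts suffice. *)
Lemma exc3_alt : exc3 A -> partitionable B 2 -> good X \/ low X.
Proof.
case=> w1 [A1 [A2 [spA cA [w11 [q1 [q1' [D1 ee1]]]] [w12 [q2 [q2' [D2 ee2]]]]]]] PB.
have EA := spl_eq spA; have spA' := split_atC spA.
have ee1' := ear_excC ee1; have ee2' := ear_excC ee2.
have sA1A : A1 \subset A by rewrite EA setUCA subsetUl.
have sA2A : A2 \subset A by rewrite EA setUA subsetUr.
have adj C1 C2 u u' D w2 v v' E w3 : split_at A w1 C1 C2 -> C1 \subset A -> ear_exc C1 w2 u u' D ->
    ear_exc C2 w3 v v' E -> e u w \/ low X.
  move=> spC sC eu ev; have [uw|uw] := boolP (e u w); [by left|right].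
  have [y yD] : exists y, y \in D.
    by apply/set0Pn; rewrite -card_gt0; have := ee_card eu; slia.
  have [t tE] : exists t, t \in E.
    by apply/set0Pn; rewrite -card_gt0; have := ee_card ev; slia.
  have [_ _ pb cb] := exc3_base spC eu ev yD tE; exists ([set u; y] :|: [set v; t] :|: J), 2, u.
  rewrite cb !inE eqxx (split_dg sp (subsetP sC _ (ee_q eu))) (split_dg spC (ee_q eu)) (negbTE uw).
  by rewrite (ee_dg eu); split=> //; case: (e u w1).
have [q1w|] := adj _ _ _ _ _ _ _ _ _ _ spA sA1A ee1 ee2; last by right.
have [q1'w|] := adj _ _ _ _ _ _ _ _ _ _ spA sA1A ee1' ee2; last by right.
have [q2w|] := adj _ _ _ _ _ _ _ _ _ _ spA' sA2A ee2 ee1; last by right.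
have [q2'w|] := adj _ _ _ _ _ _ _ _ _ _ spA' sA2A ee2' ee1; last by right.
have wA : w \notin A by apply: contra (spl_w sp); rewrite inE => ->.
have q1A := subsetP sA1A _ (ee_q ee1).
have [tW|ntW] := boolP (two_conn (w |: A)).
  have [y1 y1D] : exists y, y \in D1.
    by apply/set0Pn; rewrite -card_gt0; have := ee_card ee1; slia.
  have [y2 y2D] : exists y, y \in D2.
    by apply/set0Pn; rewrite -card_gt0; have := ee_card ee2; slia.
  left; have [_ _ pb cb] := exc3_base spA ee1 ee2 y1D y2D.
  exists ([set q1; y1] :|: [set q2; y2] :|: J), 2; rewrite cb; split=> //.
  by apply: partitionable_mono (split_partitionable sp (partitionable1 tW) PB).
have A1c : 1 < #|A| by rewrite (split_card spA) (ee_sum ee1); slia.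
have [|z [K [zA cK K0 nK]]] := ntc_attach wA cA A1c q1A _ ntW; first by rewrite e_sym.
(* For z = w1 the set K would contain all of A1 or all of A2, and with it a neighbour of w. *)
right; have := zA; rewrite EA !inE => /or3P[/eqP zw1|zA1|zA2].
- have cK' : clo (A1 :|: A2) K by have := cK; rewrite zw1 EA setU1K // (spl_w spA).
  have [x xK] := set0Pn _ K0; have := subsetP (clo_sub cK') x xK; rewrite inE => /orP[xA|xA].
    have sK : A1 \subset K.
      apply: (conn_disj_clo (ee_conn ee1) (subsetUl _ _) cK').
      by apply/set0Pn; exists x; rewrite inE xK.
    by have := nK q1 (subsetP sK _ (ee_q ee1)); rewrite q1w.
  have sK : A2 \subset K.
    apply: (conn_disj_clo (ee_conn ee2) (subsetUr _ _) cK').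
    by apply/set0Pn; exists x; rewrite inE xK.
  by have := nK q2 (subsetP sK _ (ee_q ee2)); rewrite q2w.
- exact: (exc3_low cA spA ee1 ee2 q1w q1'w q2w zA1 cK K0 nK).
exact: (exc3_low cA spA' ee2 ee1 q2w q2'w q1w zA2 cK K0 nK).
Qed.

End Exc3.

(** * Combining the alternatives on the two sides of a cut vertex *)

Lemma exc2_crit2 X : exc2 X -> exists J h u, [/\ profile X J h, u \in J, dg X u + h <= #|J| & h + 2 <= #|J|].
Proof.
case=> w [q [q' [D ee]]]; have : 0 < #|D| by have := ee_card ee; slia.
rewrite card_gt0 => /set0Pn[y yD]; exists [set q; y], 0, q.
have c2 : #|[set q; y]| = 2 by rewrite cards2; case/andP: (ee_qy ee yD) => ->.
by rewrite !inE eqxx (ee_dg ee) c2; split=> //; exact: (ee_profile ee yD).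
Qed.

Lemma exc3_crit3 X : exc3 X -> exists J h u, [/\ profile X J h, u \in J, dg X u + h <= #|J| & h + 3 <= #|J|].
Proof.
case=> w [A [B [sp cX eA eB]]].
have [w1 [q [q' [D ee]]]] := eA; have [w2 [p [p' [E ff]]]] := eB.
have [y yD] : exists y, y \in D by apply/set0Pn; rewrite -card_gt0; have := ee_card ee; slia.
have [z zE] : exists y, y \in E by apply/set0Pn; rewrite -card_gt0; have := ee_card ff; slia.
have pA := ee_profile ee yD; have pB := ee_profile ff zE.
have cA : #|[set q; y]| = 2 by rewrite cards2; case/andP: (ee_qy ee yD) => ->.
have cB : #|[set p; z]| = 2 by rewrite cards2; case/andP: (ee_qy ff zE) => ->.
exists ([set q; y] :|: [set p; z]), 1, q; rewrite (prof_dis sp pA pB) cA cB !inE eqxx; split=> //.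
  by apply: (join sp _ _ pA pB); rewrite ?cA ?cB.
rewrite (split_dg sp (ee_q ee)) (ee_dg ee); by case: (e q w).
Qed.

Lemma exc3_crit X : exc3 X -> crit X.
Proof. by case/exc3_crit3=> J [h [u [pJ uJ d _]]]; exists J, h, u; rewrite addn0. Qed.

(** The join takes at most one off the sum of the values and adds at most one to the degree of u,
    and strictness costs one more. Of these three units c come from u and 3 - c from the value of
    the other side. *)
Lemma crit_join X w A B I h u J k c : split_at X w A B -> profile A I h -> u \in I ->
  dg A u + h + c <= #|I| -> 1 < #|I| -> profile B J k -> 1 < #|J| -> k + 3 <= #|J| + c -> c <= 1 ->
  low X.
Proof.
move=> sp pI uI du I1 pJ J1 kJ c1; exists (I :|: J), (maxn h k).+1, u; split.
- exact: join sp _ _ pI pJ.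
- by rewrite inE uI.
rewrite (prof_dis sp pI pJ) (split_dg sp (subsetP (prof_sub pI) _ uI)).
have := leq_b1 (e u w); slia.
Qed.

(** A value of one would make B a single 2-connected part. *)
Lemma good_value B : good B -> B != set0 -> ~~ two_conn B ->
  exists J k, [/\ profile B J k, partitionable B (#|J| - k) & k + 2 <= #|J|].
Proof.
case=> J [k [pJ PJ]] B0 tB; exists J, k; split=> //; have kJ := prof_gt0 pJ.
rewrite leqNgt; apply: contra tB => v1; apply: partitionable1_two_conn => //.
by apply: partitionable_mono PJ; slia.
Qed.

Lemma exc_good X w A B : split_at X w A B -> exc2 A \/ exc3 A -> good B -> B != set0 -> ~~ two_conn B ->
  good X \/ low X.
Proof.
move=> sp eA gB B0 tB; have [J [k [pJ PJ kJ]]] := good_value gB B0 tB.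
have [k3|k2] := ltnP (k + 2) #|J|.
  right; have [I [h [u [pI uI du hI]]]] : exists I h u, [/\ profile A I h, u \in I, dg A u + h <= #|I| & h + 2 <= #|I|].
    case: eA => [/exc2_crit2//|/exc3_crit3[I [h [u [? ? ? ?]]]]]; exists I, h, u; split=> //; slia.
  apply: (crit_join (c := 0) sp pI uI _ _ pJ) => //; slia.
have v2 : #|J| - k = 2 by slia.
(* For k > 0 the 2 * k + 2 members give a value of at least k + 2 > 2. *)
have k0 : k = 0.
  have := prof_card pJ; case/orP=> [/andP[/eqP//]|]; slia.
rewrite k0 in pJ v2; rewrite subn0 in v2; rewrite k0 subn0 v2 in PJ.
case: eA => [[w1 [q [q' [D ee]]]]|eA]; first exact: (ear_exc_alt sp ee pJ v2 PJ).
exact: (exc3_alt sp pJ v2 eA PJ).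
Qed.

Lemma leaf_low X x : conn X -> x \in X -> 2 < #|X| -> dg X x <= 1 -> low X.
Proof.
move=> cX xX X3 d1.
have [w wX exw] : exists2 w, w \in X & e x w.
  have [|||a [w [/set1P-> wX exw]]] := @conn_edge X [set x] cX.
  - by rewrite sub1set.
  - by rewrite -card_gt0 cards1.
  - by rewrite -card_gt0; move: X3; rewrite (cardsD1 x) xX; slia.
  by exists w => //; move: wX; rewrite inE => /andP[].
have uw y : y \in X -> e x y -> y = w.
  move=> yX exy; apply/eqP; apply: contraTT d1 => nyw; rewrite -ltnNge.
  by apply/card_gt1P; exists y, w; rewrite !inE yX wX.
have xw : x != w by apply: contraTneq exw => ->; rewrite e_irr.
have [o [oX ox ow]] : exists o, [/\ o \in X, o != x & o != w].
  have : 0 < #|X :\ x :\ w|.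
    by move: X3; rewrite (cardsD1 x) xX (cardsD1 w (X :\ x)) !inE wX eq_sym xw; slia.
  by rewrite card_gt0 => /set0Pn[o]; rewrite !inE => /and3P[? ? ?]; exists o.
have cx : clo (X :\ w) [set x].
  apply/cloP; split=> [|a b]; first by rewrite sub1set !inE xw.
  by rewrite !inE => /eqP-> /andP[bw bX] /(uw b bX)/eqP; rewrite (negbTE bw).
have dgo := dg_out cx oX; rewrite !inE cards1 in dgo.
exists [set x; o], 0, x; split; last 1 first.
- by rewrite cards2 eq_sym ox addn0; slia.
- apply: profile0; last 1 first.
  + by rewrite wtU1 ?inE 1?eq_sym // wt1; have := dgo ox ow; slia.
  + by rewrite subUset !sub1set xX.
  + apply: indep2 => //; apply: contra ow => exo; by rewrite (uw o).
  by rewrite cards2.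
by rewrite !inE eqxx.
Qed.

Lemma two_conn_triangle a b c : e a b -> e b c -> e a c -> two_conn [set a; b; c].
Proof.
move=> eab ebc eac.
have ab : a != b by apply: contraTneq eab => ->; rewrite e_irr.
have bc : b != c by apply: contraTneq ebc => ->; rewrite e_irr.
have ac : a != c by apply: contraTneq eac => ->; rewrite e_irr.
have c2 p q : e p q -> conn [set p; q].
  by move=> epq; apply: (conn_link (conn1 p) (conn1 q)) epq; rewrite inE.
apply/two_connP; split.
- by rewrite setUC cardsU1 cards2 ab !inE negb_or ![c == _]eq_sym ac bc.
- by apply: (conn_link (c2 _ _ eab) (conn1 c) _ _ eac); rewrite !inE eqxx.
move=> s; rewrite !inE => /orP[/orP[]|] /eqP->.
- rewrite (_ : _ :\ _ = [set b; c]); first exact: c2.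
  by apply/setP=> x; rewrite !inE; case: (eqVneq x a) => //= ->; rewrite (negbTE ab) (negbTE ac).
- rewrite (_ : _ :\ _ = [set a; c]); first exact: c2.
  apply/setP=> x; rewrite !inE; case: (eqVneq x b) => //= [->|_]; last by rewrite orbF.
  by rewrite eq_sym (negbTE ab) (negbTE bc).
rewrite (_ : _ :\ _ = [set a; b]); first exact: c2.
apply/setP=> x; rewrite !inE; case: (eqVneq x c) => //= [->|_]; last by rewrite orbF.
by rewrite ![c == _]eq_sym (negbTE ac) (negbTE bc).
Qed.

(** Since q has degree 2, an independent triple containing it gives [low]; a disconnected O provides
    one. If O is empty or 2-connected, the triangle is one part and O at most another. *)
Lemma hang_triangle X w q q' O : conn X -> (forall x, x \in X -> 1 < dg X x) ->
  split_at X w [set q; q'] O -> e q q' -> [\/ good X, low X | exc2 X].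
Proof.
move=> cX dX sp eqq.
have nqq : q != q' by apply: contraTneq eqq => ->; rewrite e_irr.
have cX3 : #|X| = #|O| + 3 by rewrite (split_card sp) cards2 nqq; slia.
have dq : dg [set q; q'] q = 1 by rewrite dgU1E ?inE // dg1 e_irr eqq.
have dq' : dg [set q; q'] q' = 1 by rewrite dgU1E ?inE // dg1 e_irr e_sym eqq.
have qX : q \in X by rewrite (spl_eq sp) !inE eqxx orbT.
have q'X : q' \in X by rewrite (spl_eq sp) !inE eqxx !orbT.
have wq : e w q.
  by have := dX q qX; rewrite (split_dg sp) ?inE ?eqxx // dq e_sym; case: (e w q).
have wq' : e w q'.
  by have := dX q' q'X; rewrite (split_dg sp) ?inE ?eqxx ?orbT // dq' e_sym; case: (e w q').
have d2 : dg X q = 2 by rewrite (split_dg sp) ?inE ?eqxx // dq e_sym wq.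
have tW : two_conn (w |: [set q; q']) by rewrite setUA; apply: two_conn_triangle.
have spO := split_atC sp.
have nqO o : o \in O -> ~~ e q o /\ q != o.
  move=> oO; split; first by apply: (spl_no sp); rewrite ?inE ?eqxx.
  by apply: contraTneq oO => <-; rewrite (disjointFr (spl_dis sp)) // !inE eqxx.
have dO o : o \in O -> dg X o <= dg O o + 1.
  by move=> oO; rewrite (split_dg spO oO) leq_add2l leq_b1.
have OX : O \subset X by rewrite (spl_eq sp) setUA subsetUr.
have [cO|/connN[O1 [cO1 O10 O20]]] := boolP (conn O); last first.
  constructor 2; have [a aO] := set0Pn _ O10; have [b bO] := set0Pn _ O20.
  have aO' := subsetP (clo_sub cO1) a aO.
  have bO' : b \in O by move: bO; rewrite inE => /andP[].
  have ab : a != b by apply: contraTneq bO => <-; rewrite inE aO.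
  have [eqa qa] := nqO a aO'; have [eqb qb] := nqO b bO'.
  have cqab : #|q |: [set a; b]| = 3 by rewrite cardsU1 !inE negb_or qa qb cards2 ab.
  exists (q |: [set a; b]), 0, q; rewrite cqab d2 !inE eqxx; split=> //.
  apply: profile0.
  - by rewrite !subUset !sub1set qX !(subsetP OX).
  - apply: indepU1 => //; last by move=> x; rewrite !inE => /orP[]/eqP->.
    by apply: indep2 => //; apply: (noedge_clo cO1).
  - by rewrite cqab.
  rewrite wtU1 ?inE ?negb_or ?qa // wtU1 ?inE // wt1 d2 cX3.
  have := dO a aO'; have := dO b bO'.
  rewrite (dg_cloE cO1 aO) (dg_cloE (cloC cO1) bO).
  have := dg_lt aO; have := dg_lt bO; rewrite cardsD (setIidPr (clo_sub cO1)).
  have := subset_leq_card (clo_sub cO1); slia.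
have [O0|O0] := eqVneq O set0.
  constructor 1; exists [set q], 0; rewrite cards1 subn0; split.
    apply: profile0; rewrite ?cards1 ?sub1set ?indep1 //.
    by rewrite wt1 d2 cX3 O0 cards0.
  by rewrite (spl_eq sp) O0 setU0; apply: partitionable1.
have [o oO] := set0Pn _ O0; have [eqo qo] := nqO o oO.
have cqo : #|[set q; o]| = 2 by rewrite cards2 qo.
have [tO|tO] := boolP (two_conn O).
  constructor 1; exists [set q; o], 0; rewrite cqo subn0; split; last first.
    exact: split_partitionable sp (partitionable1 tW) (partitionable1 tO).
  apply: profile0; rewrite ?cqo //.
  - by rewrite subUset !sub1set qX (subsetP OX).
  - exact: indep2.
  rewrite wtU1 ?inE // wt1 d2 cX3; have := dO o oO; have := dg_lt oO; slia.
constructor 3; exists w, q, q', O; split=> //.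
rewrite ltnNge; apply/negP=> O1; have := dX o (subsetP OX _ oO).
have := dO o oO; have := dg_lt oO; slia.
Qed.

(** * The trichotomy *)

Definition exc X := exc1 X \/ exc2 X \/ exc3 X.

Lemma exc_crit X : exc X -> crit X.
Proof.
by case=> [|[]]; [apply: exc1_crit|apply: exc2_crit|apply: exc3_crit].
Qed.

Definition failing X w C k := [/\ hang X w C, partitionable (w |: C) k & ~~ partitionable C k].

Lemma ex_min_card (P : {set T} -> Prop) : (exists C, P C) ->
  exists C, P C /\ forall D, P D -> #|C| <= #|D|.
Proof.
case=> C; have [n] := ubnP #|C|; elim: n C => // n IH C; rewrite ltnS => leC PC.
have [[D PD ltD]|H] := classic (exists2 D, P D & #|D| < #|C|).
  by apply: (IH D) => //; apply: leq_trans leC.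
by exists C; split=> // D PD; rewrite leqNgt; apply/negP=> ltD; case: H; exists D.
Qed.

(** Every set is safe here, so X - w is flexible at w. If w is included in the partition, J is a
    profile with h = 0. In the detached case w joins J, and its degree is at most the old size of
    J. *)
Lemma no_failing_alt X : X != set0 -> conn X -> (forall x, x \in X -> 1 < dg X x) ->
  ~ (exists w C k, failing X w C k) -> good X \/ low X.
Proof.
move=> X0 cX dX nf; have [w wX] := set0Pn _ X0.
have sf Z : safe X Z.
  by move=> z K k zZ sK hK P; apply: contraT => nP; case: nf; exists z, K, k.
have wXw : w \notin X :\ w by rewrite !inE eqxx.
have EX : w |: (X :\ w) = X by rewrite setD1K.
have cU : clo (X :\ w) (X :\ w) by apply/cloP; rewrite subxx.
have cX1 : #|X| = #|X :\ w|.+1 by rewrite (cardsD1 w) wX.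
have H K r : #|K| < #|X| -> hang X r K -> safe X K -> [\/ joined K r, detached K r | low X].
  by move=> _; apply: hang_alternative.
have [|/=] := pieces_flexible H (sf X) wX (subxx X) (subsetDl _ _) cU; last by right.
case=> [[J [sJ iJ PJ PX wJ]]|[J [sJ iJ PJ nJ [wJ dJ]]]].
  rewrite EX in PX wJ; left; exists J, 0; rewrite subn0; split=> //.
  apply: profile0; rewrite ?(partitionable_gt0 X0 PX) //; last by rewrite cX1 addn1 ltnS.
  exact: subset_trans sJ (subsetDl _ _).
right; have wJ' : w \notin J by apply: contra wXw; apply: (subsetP sJ).
have dw : dg X w = dg (X :\ w) w by rewrite -{1}EX dgU1E // e_irr.
exists (w |: J), 0, w; rewrite !inE eqxx cardsU1 wJ' dw addn0 addn1; split=> //.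
apply: profile0; rewrite ?cardsU1 ?wJ' //.
- by rewrite subUset sub1set wX (subset_trans sJ) // subsetDl.
- exact: indepU1.
rewrite wtU1 // dw cX1 addn1 ltnS addnC; apply: leq_trans wJ; rewrite leq_add2r.
by rewrite -{1}EX; apply: leq_sum => x xJ; apply: dgU1n; rewrite e_sym nJ.
Qed.

(** A failing piece inside C would be smaller, so C is safe and [hang_alternative] pays for w + C.
    This settles an empty or 2-connected rest Y. Beyond the hanging triangles, C and Y both have
    profiles of value at least 2, which can be joined at w. *)
Lemma failing_alt X w C k : conn X -> (forall x, x \in X -> 1 < dg X x) ->
  (forall Y, #|Y| < #|X| -> Y != set0 -> [\/ good Y, low Y | exc Y]) ->
  failing X w C k -> (forall w' C' k', failing X w' C' k' -> #|C| <= #|C'|) ->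
  [\/ good X, low X | exc X].
Proof.
move=> cX dX IH [hC PCw nPC] minC; have [wX C0 cC cnC] := hC.
have sp := split_of wX cC; set Y := X :\ w :\: C in sp; have spY := split_atC sp.
have wC := clo_notin cC; have sCX := clo_D1 cC.
have cardX := split_card sp.
have sYX : Y \subset X by rewrite (spl_eq sp) setUA subsetUr.
have dC x : x \in C -> 0 < dg C x.
  by move=> xC; have := dX x (subsetP sCX _ xC); rewrite (split_dg sp xC); case: (e x w); slia.
have dY x : x \in Y -> 0 < dg Y x.
  by move=> xY; have := dX x (subsetP sYX _ xY); rewrite (split_dg spY xY); case: (e x w); slia.
have triangle q q' O : split_at X w [set q; q'] O -> e q q' -> [\/ good X, low X | exc X].
  move=> spq eqq; case: (hang_triangle cX dX spq eqq) => ?; [constructor 1|constructor 2|constructor 3] => //.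
  by right; left.
have two S : split_at X w S (X :\ w :\: S) -> conn S -> #|S| = 2 -> [\/ good X, low X | exc X].
  move=> spS cS /eqP/cards2P[q [q' [nqq ES]]]; rewrite ES in spS cS.
  apply: triangle spS _.
  have [|||x [y [/set1P-> + exy]]] := @conn_edge [set q; q'] [set q] cS.
  - by rewrite sub1set !inE eqxx.
  - by apply/set0Pn; exists q; rewrite inE.
  - by apply/set0Pn; exists q'; rewrite !inE eqxx orbT andbT eq_sym.
  by rewrite !inE => /andP[/negbTE->] /eqP<-.
have [C3|C2] := ltnP 2 #|C|; last first.
  have C1 : #|C| <> 1.
    move=> C1; have [x xC] := set0Pn _ C0; have := dg_lt xC; rewrite C1.
    by have := dC x xC; case: (dg C x).
  by apply: (two C) => //; move: C2 C1 C0; rewrite -card_gt0; case: #|C| => [|[|[|]]].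
have ntC : ~~ two_conn C.
  apply: contra nPC => tC; apply: partitionable_mono (partitionable1 tC); apply: partitionable_gt0 PCw.
  by apply/set0Pn; exists w; rewrite !inE eqxx.
have sf : safe X C.
  move=> z K l zC sK hK P; apply: contraT => nP.
  have : #|C| <= #|K| by apply: (minC z K l); split.
  by rewrite leqNgt proper_card.
have [lX|nlX] := classic (low X); first by constructor 2.
have [J [sJ iJ PJ wJ]] : exists J, [/\ J \subset C, indep J, partitionable (w |: C) #|J| & wt X J <= #|C|].
  case: (hang_alternative cX dX hC sf) => [[J [sJ iJ PJ wJ]]|[J [sJ iJ PJ nJ [wJ dJ]]]|//].
    by exists J; split=> //; rewrite (wt_local cC).
  exists J; split=> //.
    (* In the detached case C itself has #|J| parts, which must be at least k, so the given
       partition of w + C is cheap enough. *)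
    apply: partitionable_mono PCw; apply: contraR nPC; rewrite -ltnNge => /ltnW lt.
    exact: partitionable_mono lt PJ.
  rewrite (wt_local cC) //; apply: leq_trans (leq_trans (leq_addr _ _) wJ).
  by apply: leq_sum => x xJ; apply: dgU1n; rewrite e_sym nJ.
have J0 : 0 < #|J|.
  by apply: partitionable_gt0 PJ; apply/set0Pn; exists w; rewrite !inE eqxx.
have sJX : J \subset X := subset_trans sJ sCX.
have [Y0|Y0] := eqVneq Y set0.
  constructor 1; exists J, 0; rewrite subn0; split; last by rewrite (spl_eq sp) Y0 setU0.
  by apply: profile0 => //; rewrite cardX Y0 cards0; slia.
have [tY|ntY] := boolP (two_conn Y).
  constructor 1; have [y yY] := set0Pn _ Y0.
  have yJ : y \notin J by apply/negP=> /(subsetP sJ); rewrite (disjointFl (spl_dis sp) yY).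
  exists (y |: J), 0; rewrite subn0 cardsU1 yJ add1n -addn1; split; last first.
    exact: split_partitionable sp PJ (partitionable1 tY).
  apply: profile0; rewrite ?cardsU1 ?yJ //.
  - by rewrite subUset sub1set (subsetP sYX).
  - apply: indepU1 => // x xJ; apply: (noedge_sym (spl_no sp)) => //.
    exact: (subsetP sJ).
  rewrite wtU1 // cardX (split_dg spY yY); have := dg_lt yY; have := leq_b1 (e y w); slia.
have ltC : #|C| < #|X| by rewrite cardX; move: Y0; rewrite -card_gt0; slia.
have ltY : #|Y| < #|X| by rewrite cardX; slia.
have n1C : ~ exc1 C by move=> [q [q' [_ _ EC]]]; move: C3; rewrite EC cards2; case: (q != q').
have [[q [q' [nqq eqq EY]]]|n1Y] := classic (exc1 Y).
  by apply: (triangle q q' C) => //; rewrite -EY.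
have val2 S : S != set0 -> ~~ two_conn S -> (forall x, x \in S -> 0 < dg S x) -> ~ exc1 S ->
    [\/ good S, low S | exc S] -> exists J k, profile S J k /\ k + 2 <= #|J|.
  move=> S0 tS dS n1 [gS|[I [h [u [pI uI du]]]]|[//|[/exc2_crit2|/exc3_crit3]]].
  - by have [I [h [pI _ hI]]] := good_value gS S0 tS; exists I, h.
  - exists I, h; split=> //; have := dS u (subsetP (prof_sub pI) _ uI); slia.
  - by move=> [I [h [u [pI _ _ hI]]]]; exists I, h.
  by move=> [I [h [u [pI _ _ hI]]]]; exists I, h; split=> //; slia.
have aC := IH C ltC C0; have aY := IH Y ltY Y0.
have vC := val2 C C0 ntC dC n1C aC; have vY := val2 Y Y0 ntY dY n1Y aY.
have lowj A B : split_at X w A B -> (forall x, x \in A -> 0 < dg A x) -> low A ->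
    (exists J k, profile B J k /\ k + 2 <= #|J|) -> low X.
  move=> spA dA [I [h [u [pI uI du]]]] [I' [k' [pI' kI']]].
  apply: (crit_join (c := 1) spA pI uI du _ pI') => //; try slia.
  have := dA u (subsetP (prof_sub pI) _ uI); slia.
have excj A B : split_at X w A B -> exc2 A -> exc3 B -> low X.
  move=> spA /(exc2_crit2)[I [h [u [pI uI du hI]]]] /(exc3_crit3)[I' [h' [u' [pI' _ _ hI']]]].
  apply: (crit_join (c := 0) spA pI uI _ _ pI') => //; slia.
case: aC => [gC|lC|eC]; last 1 first.
- have {}eC : exc2 C \/ exc3 C by case: eC.
  case: aY => [gY|lY|eY].
  + case: (exc_good sp eC gY Y0 ntY) => ?; [by constructor 1|by constructor 2].
  + by constructor 2; apply: lowj spY dY lY vC.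
  have {}eY : exc2 Y \/ exc3 Y by case: eY.
  case: eC eY => eC [] eY.
  + by constructor 3; right; right; exists w, C, Y.
  + by constructor 2; apply: excj sp eC eY.
  + by constructor 2; apply: excj spY eY eC.
  constructor 2; have [I [h [u [pI uI du hI]]]] := exc3_crit3 eC.
  have [I' [h' [u' [pI' _ _ hI']]]] := exc3_crit3 eY.
  apply: (crit_join (c := 0) sp pI uI _ _ pI') => //; slia.
- case: aY => [gY|lY|eY]; last 1 first.
  + have {}eY : exc2 Y \/ exc3 Y by case: eY.
    case: (exc_good spY eY gC C0 ntC) => ?; [by constructor 1|by constructor 2].
  + constructor 1; have [I [h [pI PI hI]]] := good_value gC C0 ntC.
    have [I' [h' [pI' PI' hI']]] := good_value gY Y0 ntY.
    (* C has no partition into k parts, so its value exceeds k; this is the unit lost in the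
       join. *)
    have ltk : k < #|I| - h.
      by rewrite ltnNge; apply: contra nPC => le; apply: partitionable_mono PI.
    exists (I :|: I'), (maxn h h').+1; split.
      by apply: (join sp _ _ pI pI'); slia.
    rewrite (prof_dis sp pI pI'); apply: partitionable_mono (split_partitionable sp PCw PI'); slia.
  by constructor 2; apply: lowj spY dY lY vC.
by constructor 2; apply: lowj sp dC lC vY.
Qed.

Theorem alternative X : X != set0 -> [\/ good X, low X | exc X].
Proof.
have [n] := ubnP #|X|; elim: n X => // n IH X; rewrite ltnS => leX X0.
have IH' Y : #|Y| < #|X| -> Y != set0 -> [\/ good Y, low Y | exc Y].
  by move=> ltY; apply: IH; apply: leq_trans leX.
have [cX|/connN[A [cA A0 nA]]] := boolP (conn X); last first.
  have gc Y : #|Y| < #|X| -> Y != set0 -> good Y \/ crit Y.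
    by move=> ltY Y0; case: (IH' Y ltY Y0) => [|/low_crit|/exc_crit]; [left|right|right].
  have EX : X = A :|: (X :\: A) by rewrite -{1}(setID X A) (setIidPr (clo_sub cA)).
  have dA : [disjoint A & X :\: A] by rewrite disjoint_sym disjoints_subset setDE subsetIr.
  have := disconnected_alt dA (noedge_clo cA)
    (gc A (card_lt_sub (clo_sub cA) nA) A0) (gc _ (card_setD_lt (clo_sub cA) A0) nA).
  by rewrite -EX => -[]; [constructor 1|constructor 2].
have [X1|X1] := leqP #|X| 1.
  have [x xX] := set0Pn _ X0; have EX : X = [set x].
    by apply/eqP; rewrite eq_sym eqEcard sub1set xX cards1.
  constructor 2; exists [set x], 0, x; rewrite EX inE cards1 dg1 e_irr; split=> //.
  by apply: profile0; rewrite ?cards1 ?indep1 // wt1 dg1 e_irr.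
have [X2|X2] := leqP #|X| 2.
  have /cards2P[q [q' [nqq EX]]] : #|X| == 2 by rewrite eqn_leq X2.
  constructor 3; left; exists q, q'; split=> //.
  have [|||x [y [/set1P-> + exy]]] := @conn_edge X [set q] cX.
  - by rewrite sub1set EX !inE eqxx.
  - by apply/set0Pn; exists q; rewrite inE.
  - by apply/set0Pn; exists q'; rewrite EX !inE eqxx orbT andbT eq_sym.
  by rewrite EX !inE => /andP[/negbTE->] /eqP<-.
have [[x xX d1]|dX] := classic (exists2 x, x \in X & dg X x <= 1).
  by constructor 2; apply: leaf_low d1.
have {}dX x : x \in X -> 1 < dg X x.
  by move=> xX; rewrite ltnNge; apply/negP=> d1; apply: dX; exists x.
have [[w [C [k fC]]]|nf] := classic (exists w C k, failing X w C k); last first.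
  by case: (no_failing_alt X0 cX dX nf); [constructor 1|constructor 2].
have [|C0 [[w0 [k0 f0]] minC]] := @ex_min_card (fun C => exists w k, failing X w C k).
  by exists C, w, k.
by apply: (failing_alt cX dX IH' f0) => w' C' k' f'; apply: minC; exists w', k'.
Qed.

(** * The whole graph *)

Lemma degE u : deg e u = dg [set: T] u.
Proof. by apply: eq_card => v; rewrite !inE. Qed.

Lemma weightE I : weight e I = wt [set: T] I.
Proof. by apply: eq_bigr => u _; rewrite degE. Qed.

Lemma sigma_star_large I u : (if sigma_star e is Some s then #|T| <= s : Prop else True) ->
  indep I -> u \in I -> dg [set: T] u < #|I| -> #|T| <= wt [set: T] I.
Proof.
move=> + iI uI du; have lI : large_indep e I.
  rewrite /large_indep iI /large addn1; apply: leq_ltn_trans du; rewrite -degE.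
  by apply: big_minn_le => //; rewrite mem_index_enum.
rewrite /sigma_star; case: existsP => [_|[]]; last by exists I.
move=> h; apply: leq_trans h _; rewrite -weightE.
by apply: big_minn_le => //; rewrite mem_index_enum.
Qed.

Section Star.
Hypothesis star : forall I u, indep I -> u \in I -> dg [set: T] u < #|I| -> #|T| <= wt [set: T] I.

(** Let d be the smallest degree, attained at y, and suppose d is below the value. If d <= h,
    [prof_small] provides d companions of y. If d > h, keeping y and d others takes at least f(d)
    off the weight, where f(x) = x (#|J| - 1 - x). As h < d <= #|J| - 1 - h and f is concave and
    symmetric, f(d) is at least the slack f(h). Either way d + 1 independent vertices weigh less
    than n. *)
Lemma profile_dg J h x : profile [set: T] J h -> x \in J -> #|J| - h <= dg [set: T] x.
Proof.
move=> pJ xJ; have [_ iJ _ wJ smJ _] := pJ; rewrite cardsT in wJ smJ.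
have [y yJ ymin] : exists2 y, y \in J & forall z, z \in J -> dg [set: T] y <= dg [set: T] z.
  by case: (@arg_minnP _ x (mem J) (dg [set: T]) xJ) => y; exists y.
apply: leq_trans (ymin x xJ); rewrite leqNgt; apply/negP=> lt.
have [dh|hd] := leqP (dg [set: T] y) h.
  have [I [sI yI cI wI]] := smJ _ y dh yJ ymin.
  have : #|T| <= wt [set: T] (y |: I).
    apply: (star (u := y)); rewrite ?inE ?eqxx //; last by rewrite cardsU1 yI cI.
    by apply: indepS iJ; rewrite subUset sub1set yJ.
  rewrite wtU1 //; slia.
have hq : 0 < (dg [set: T] y).+1 <= #|J| by slia.
have [I [sI yI cI wI]] := wt_drop yJ hq ymin.
have : #|T| <= wt [set: T] I.
  by apply: (star (u := y)) => //; [apply: indepS iJ|rewrite cI].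
move: wJ wI lt hd; set d := dg _ y; set M := #|J|; clear; nia.
Qed.

Lemma profile_alpha_star J h : profile [set: T] J h -> #|J| - h <= alpha_star e.
Proof.
move=> pJ; have [sJ iJ _ wJ _ _] := pJ; rewrite cardsT in wJ.
have [u uJ] := prof_mem pJ; have hJ := prof_gt0 pJ.
have hq : 0 < #|J| - h <= #|J| by slia.
have [I [sI uI cI wI]] := wt_drop uJ hq (fun x => @profile_dg J h x pJ).
rewrite -{1}cI; apply: (@leq_bigmax_cond _ (fun K => indep K && light e K) (fun K => #|K|)).
rewrite (indepS sI iJ) /light weightE.
move: wJ wI hJ; set M := #|J|; clear; nia.
Qed.

Lemma star_not_low : ~ low [set: T].
Proof.
case=> J [h [u [pJ uJ du]]]; have := profile_dg pJ uJ; have := prof_gt0 pJ; slia.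
Qed.

Lemma star_good : good [set: T] ->
  exists P, two_proper_partition e P /\ #|P| <= alpha_star e.
Proof.
case=> J [h [pJ /partitionableP[P [pP tP cP]]]]; exists P; split.
  by split=> // B /tP; apply: two_conn_two_connected_on.
exact: leq_trans cP (profile_alpha_star pJ).
Qed.

(** * Tightness and the listed graphs *)

Lemma exc1_iso : exc1 [set: T] -> isomorphic e K2.
Proof.
case=> q [q' [nqq eqq ET]].
apply: (@isomorphic_edge_list _ _ e_sym e_irr _ _ q [:: q; q']) => //=.
- by move=> x; have := in_setT x; rewrite ET !inE.
- by rewrite -cardsT ET cards2 nqq.
by rewrite eqq.
Qed.

Lemma noedgeF A B x y : noedge A B -> x \in A -> y \in B -> e x y = false.
Proof. by move=> n xA yB; apply/negbTE/n. Qed.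

Lemma conn_pair y y' : conn [set y; y'] -> y != y' -> e y y'.
Proof.
move=> cD nyy; have [|||x [z [/set1P-> + exz]]] := @conn_edge _ [set y] cD.
- by rewrite sub1set !inE eqxx.
- by apply/set0Pn; exists y; rewrite inE.
- by apply/set0Pn; exists y'; rewrite !inE eqxx orbT andbT eq_sym.
by rewrite !inE => /andP[/negbTE->] /eqP<-.
Qed.

Lemma exc2_F5 w q q' D : ear_exc [set: T] w q q' D -> #|D| = 2 -> isomorphic e F5.
Proof.
move=> ee D2; have [sp n eqq wq wq' _ cD _ _] := ee.
have /eqP/cards2P[y [y' [nyy ED]]] := D2.
have yD : y \in D by rewrite ED !inE eqxx.
have y'D : y' \in D by rewrite ED !inE eqxx orbT.
have adj x : x \in D -> e w x.
  move=> xD; have := profile_dg (x := x) (ee_profile ee xD).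
  rewrite !inE eqxx orbT cards2 (ee_dgD ee xD); have /andP[-> _] := ee_qy ee xD.
  by move=> /(_ isT); have := dg_lt xD; rewrite D2 e_sym; case: (e w x) => //; slia.
have eyy : e y y' by apply: conn_pair nyy; rewrite -ED.
have no := spl_no sp.
apply: (@isomorphic_edge_list _ _ e_sym e_irr _ _ q [:: w; q; q'; y; y']) => //=.
- by move=> x; have := in_setT x; rewrite (spl_eq sp) ED !inE -!orbA.
- by rewrite -cardsT (ee_sum ee) D2.
  by rewrite wq wq' eqq eyy !adj.
rewrite !no // !inE eqxx ?orbT //.
Qed.

End Star.

Lemma dg_full A x : x \in A -> #|A| <= (dg A x).+1 -> forall y, y \in A -> e x y = (x != y).
Proof.
move=> xA full y yA; case: eqVneq => [<-|nxy] /=; first exact: e_irr.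
apply: contraTT full => nxy'; rewrite -ltnNge.
have s : [set z in A | e x z] \subset A :\ x :\ y.
  apply/subsetP=> z; rewrite !inE => /andP[-> exz]; rewrite andbT.
  by apply/andP; split; apply: contraTneq exz => ->; rewrite ?e_irr.
have := subset_leq_card s; rewrite (cardsD1 x A) xA (cardsD1 y (A :\ x)) !inE eq_sym nxy yA /=.
rewrite -/(dg A x); slia.
Qed.

Lemma ntc_split D : conn D -> ~~ two_conn D -> 2 < #|D| ->
  exists c A B, [/\ split_at D c A B, A != set0, B != set0 & #|A| <= #|B|].
Proof.
move=> cD tD D2.
have [c [A [cDc cA A0 B0]]] : exists c A, [/\ c \in D, clo (D :\ c) A, A != set0 & D :\ c :\: A != set0].
  move: tD; rewrite /two_conn D2 cD /= => /forall_inPn[c cDc /connN[A [cA A0 nA]]].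
  by exists c, A.
have sp := split_of cDc cA; have [le|/ltnW le] := leqP #|A| #|D :\ c :\: A|.
  by exists c, A, (D :\ c :\: A).
by exists c, (D :\ c :\: A), A; split=> //; apply: split_atC.
Qed.

Section Star.
Hypothesis star : forall I u, indep I -> u \in I -> dg [set: T] u < #|I| -> #|T| <= wt [set: T] I.

(** For y, z on different sides of a cut vertex c of D, the set {q, y, z} is large because q has
    degree 2. Its weight is at most 2 + #|A| + 1 + #|B| + 1 = n, so equality holds: A and B are
    cliques completely joined to c and w, and only the edge between w and c is left open. *)
Lemma exc2_H w q q' D : ear_exc [set: T] w q q' D -> 2 < #|D| ->
  exists s t : nat, [/\ 2 <= s, s <= t, s + t + 2 = #|T| & exists withab : bool, isomorphic e (Hst s t withab)].
Proof.
move=> ee D2; have [sp n eqq wq wq' _ cD tD _] := ee.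
have [c [A [B [spD A0 B0 AB]]]] := ntc_split cD tD D2.
have spD' := split_atC spD; have no := spl_no sp; have noAB := spl_no spD.
have cardD := split_card spD; have cT := ee_sum ee; rewrite cardsT in cT.
have sAD : A \subset D by rewrite (spl_eq spD) setUCA subsetUl.
have sBD : B \subset D by rewrite (spl_eq spD) setUA subsetUr.
have cDm : c \in D := split_mem spD.
have tight y z : y \in A -> z \in B -> [/\ #|A| <= (dg A y).+1, e y c, e y w &
    [/\ #|B| <= (dg B z).+1, e z c & e z w]].
  move=> yA zB; have yD := subsetP sAD y yA; have zD := subsetP sBD z zB.
  have /andP[qy nqy] := ee_qy ee yD; have /andP[qz nqz] := ee_qy ee zD.
  have yz : y != z by apply: contraTneq zB => <-; rewrite (disjointFr (spl_dis spD)).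
  have : #|T| <= wt [set: T] (q |: [set y; z]).
    apply: (star (u := q)); rewrite ?inE ?eqxx //.
      apply: indepU1 => //; first by apply: indep2 => //; apply: noAB.
      by move=> x; rewrite !inE => /orP[]/eqP->.
    by rewrite cardsU1 !inE negb_or qy qz cards2 yz (ee_dg ee).
  rewrite !wtU1 ?inE ?negb_or ?qy // wt1 (ee_dg ee) !(ee_dgD ee) //.
  rewrite (split_dg spD yA) (split_dg spD' zB) cT cardD.
  have := dg_lt yA; have := dg_lt zB; move=> h1 h2.
  case: (e y c); case: (e y w); case: (e z c); case: (e z w) => h3; do ?split=> //; slia.
have [a aA] := set0Pn _ A0; have [b bB] := set0Pn _ B0.
have adjA y : y \in A -> [/\ forall z, z \in A -> e y z = (y != z), e y c & e y w].
  by move=> yA; have [h ? ? _] := tight y b yA bB; split=> //; apply: dg_full.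
have adjB y : y \in B -> [/\ forall z, z \in B -> e y z = (y != z), e y c & e y w].
  by move=> yB; have [_ _ _ [h ? ?]] := tight a y aA yB; split=> //; apply: dg_full.
have A1 : 0 < #|A| by rewrite card_gt0.
exists #|A|.+1, #|B|.+1; split; rewrite ?ltnS //; first by slia.
exists (e w c); pose S := [:: w; c; q; q'] ++ enum A ++ enum B.
have wD : w \notin D by apply: contra (spl_w sp); rewrite !inE => ->; rewrite orbT.
have cov x : x \in S.
  have := in_setT x; rewrite /S (spl_eq sp) (spl_eq spD) !inE !mem_cat !mem_enum.
  by do 4![case: (x == _); rewrite ?orbT //=].
have szS : size S = #|A|.+1 + #|B|.+1 + 2.
  by rewrite /S !size_cat /= -!cardE; slia.
have cTS : #|T| = #|A|.+1 + #|B|.+1 + 2 by slia.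
apply: (isomorphic_seq (x0 := q) cov szS cTS) => i j.
have us : uniq S by apply/card_uniqP; rewrite szS -cTS; apply: eq_card => x; rewrite cov.
(* Ties a position in S to its block, so that edges are compared block by block. *)
pose kind (i : nat) x := [\/ i = 0 /\ x = w, i = 1 /\ x = c, i = 2 /\ x = q | i = 3 /\ x = q'] \/
  (4 <= i <= #|A| + 3 /\ x \in A) \/ (#|A| + 4 <= i /\ x \in B).
have kindP (k : 'I_(#|A|.+1 + #|B|.+1 + 2)) : kind k (nth q S k).
  have := ltn_ord k; rewrite /S; move: (nat_of_ord k) => m; case: m => [|[|[|[|m]]]] /=.
  - by left; constructor 1. - by left; constructor 2. - by left; constructor 3. - by left; constructor 4.
  rewrite nth_cat -cardE => mlt; case: ltnP => hm; right; [left|right].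
    by split; [slia|rewrite -mem_enum mem_nth // -cardE].
  by split; [slia|rewrite -mem_enum mem_nth // -cardE; slia].
have ewA x : x \in A -> e w x by move=> /adjA[_ _]; rewrite e_sym.
have ewB x : x \in B -> e w x by move=> /adjB[_ _]; rewrite e_sym.
have ecA x : x \in A -> e c x by move=> /adjA[_]; rewrite e_sym.
have ecB x : x \in B -> e c x by move=> /adjB[_]; rewrite e_sym.
have nqD x : x \in D -> e q x = false /\ e q' x = false.
  by move=> xD; split; apply: (noedgeF no); rewrite // !inE eqxx ?orbT.
have [nqc nq'c] := nqD c cDm.
have nqA x : x \in A -> e q x = false /\ e q' x = false by move=> /(subsetP sAD)/nqD.
have nqB x : x \in B -> e q x = false /\ e q' x = false by move=> /(subsetP sBD)/nqD.
have val (k l : nat) x y : k <= l -> kind k x -> kind l y -> (k == l) = (x == y) ->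
    e x y = (if k == 0 then if l == 1 then e w c else l != 0 else
    if k == 1 then 3 < l else if k == 2 then l == 3 else
    [&& 3 < k, 3 < l, k != l & (l <= #|A| + 3) || (#|A| + 3 < k)]).
  have ge4 m (u v u' F : bool) : 4 <= m ->
      (if m == 0 then u else if m == 1 then v else if m == 2 then u' else F) = F.
    by case: m => [|[|[|m]]].
  move=> kl [[]|[]] [hk hx] [[]|[]] [hl hy] Ekl; try (exfalso; clear -kl hk hl; lia);
  rewrite ?hx ?hy ?hk ?hl /= ?e_irr ?nqc ?nq'c ?wq ?wq' ?eqq //.
  - rewrite ewA //; clear -hl; case: eqP; lia.
  - rewrite ewB //; clear -hl; case: eqP; lia.
  - by rewrite e_sym.
  - by rewrite e_sym nq'c.
  - rewrite ecA //; clear -hl; lia.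
  - rewrite ecB //; clear -hl; lia.
  - rewrite (proj1 (nqA _ hy)); clear -hl; lia.
  - rewrite (proj1 (nqB _ hy)); clear -hl; lia.
  - rewrite (proj2 (nqA _ hy)); clear -hl; lia.
  - rewrite (proj2 (nqB _ hy)); clear -hl; lia.
  - rewrite ge4; last by case/andP: hk.
    have [H _ _] := adjA _ hx; rewrite H // -Ekl; clear -hk hl; lia.
  - rewrite ge4; last by case/andP: hk.
    rewrite (noedgeF noAB hx hy); clear -hk hl; lia.
  - rewrite ge4; last by clear -hk; slia.
    have [H _ _] := adjB _ hx; rewrite H // -Ekl; clear -hk hl; lia.
have eqn (k l : 'I_(#|A|.+1 + #|B|.+1 + 2)) : (k == l :> nat) = (nth q S k == nth q S l).
  by rewrite nth_uniq ?szS.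
have lt (k l : 'I_(#|A|.+1 + #|B|.+1 + 2)) : k <= l ->
    Hst #|A|.+1 #|B|.+1 (e w c) k l = e (nth q S k) (nth q S l).
  move=> kl; rewrite (val _ _ _ _ kl (kindP k) (kindP l) (eqn k l)) /Hst -val_eqE /=.
  exact: H_adj_le.
have [/lt//|/ltnW/lt H] := leqP i j.
by rewrite [RHS]e_sym -H /Hst eq_sym orbC.
Qed.

End Star.

Definition K2_side w w1 D := exists y y',
  [/\ D = [set y; y'], #|D| = 2, e y y' & forall x, x \in D -> e w x /\ e w1 x].

(** In [F12] the middle vertex c is the vertex c_9, and the final disjunction is the condition on L
    there. *)
Definition P3_side w w1 D := exists a c a',
  [/\ D = [set a; c; a'], #|D| = 3, [/\ e a c, e a' c & e a a' = false],
      [/\ e w a, e w1 a, e w a' & e w1 a'] & e w c || e w1 c].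

(** d stands for the degree in the whole graph. A vertex on the smaller side A of a cut vertex of D
    has degree at most #|A| + 2, which must reach #|D| = #|A| + #|B| + 1. So both sides are single
    vertices. *)
Lemma side_shape w w1 D (d : T -> nat) : conn D -> ~~ two_conn D -> 1 < #|D| ->
  (forall x, x \in D -> [/\ d x = dg D x + e w1 x + e w x, 3 <= d x & #|D| <= d x]) ->
  K2_side w w1 D \/ (P3_side w w1 D /\ exists2 x, x \in D & d x <= #|D|).
Proof.
move=> cD tD D1 H; have [D2|D2] := leqP #|D| 2.
  left; have D2' : #|D| = 2 by slia.
  have /eqP/cards2P[y [y' [nyy ED]]] := D2'.
  exists y, y'; split=> //; first by apply: conn_pair nyy; rewrite -ED.
  move=> x xD; have [-> d3 _] := H x xD; have := dg_lt xD; move: d3; rewrite D2'.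
  by case: (e w x); case: (e w1 x) => //; slia.
right; have [c [A [B [sp A0 B0 AB]]]] := ntc_split cD tD D2.
have sp' := split_atC sp; have cD3 := split_card sp.
have [a aA] := set0Pn _ A0; have [b bB] := set0Pn _ B0.
have sAD : A \subset D by rewrite (spl_eq sp) setUCA subsetUl.
have sBD : B \subset D by rewrite (spl_eq sp) setUA subsetUr.
have aD := subsetP sAD a aA; have bD := subsetP sBD b bB; have cDm := split_mem sp.
have [da da3 daD] := H a aD; have [db db3 dbD] := H b bD.
rewrite (split_dg sp aA) in da; rewrite (split_dg sp' bB) in db.
have la := dg_lt aA; have lb := dg_lt bB.
have a1 := leq_b1 (e a c); have a2 := leq_b1 (e w1 a); have a3 := leq_b1 (e w a).
have b1 := leq_b1 (e b c); have b2 := leq_b1 (e w1 b); have b3 := leq_b1 (e w b).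
have A1 : #|A| = 1 by slia.
have B1 : #|B| = 1 by slia.
have EA : A = [set a] by apply/eqP; rewrite eq_sym eqEcard sub1set aA cards1 A1.
have EB : B = [set b] by apply/eqP; rewrite eq_sym eqEcard sub1set bB cards1 B1.
split; last by exists a => //; slia.
have D3 : #|D| = 3 by slia.
exists a, c, b; split=> //.
- by rewrite (spl_eq sp) EA EB setUA [c |: [set a]]setUC.
- split; last exact: noedgeF (spl_no sp) aA bB.
    by case: (e a c) da => //; slia.
  by case: (e b c) db => //; slia.
- split.
  + by case: (e w a) da a3 => //; slia.
  + by case: (e w1 a) da a2 => //; slia.
  + by case: (e w b) db b3 => //; slia.
  by case: (e w1 b) db b2 => //; slia.
have [dc dc3 _] := H c cDm; have := dg_lt cDm; move: dc dc3; rewrite D3.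
by case: (e w c); case: (e w1 c) => //; slia.
Qed.

Section Star.
Hypothesis star : forall I u, indep I -> u \in I -> dg [set: T] u < #|I| -> #|T| <= wt [set: T] I.

(** The profile of four members with h = 1 forces all degrees to be at least 3, whence q1 is
    adjacent to w. As q1 has degree at most 3, the four members form a large set; q1 and q2
    contribute at most 6 to its weight, and n = #|D1| + #|D2| + 7. *)
Lemma exc3_tight w A B w1 q1 q1' D1 w2 q2 q2' D2 : split_at [set: T] w A B ->
  ear_exc A w1 q1 q1' D1 -> ear_exc B w2 q2 q2' D2 ->
  forall x y, x \in D1 -> y \in D2 ->
  [/\ e w q1, 3 <= dg [set: T] x & #|D1| + #|D2| + 1 <= dg [set: T] x + dg [set: T] y].
Proof.
move=> sp ee1 ee2 x y xD yD; have sp' := split_atC sp.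
have p1 := ee_profile ee1 xD; have p2 := ee_profile ee2 yD.
have c1 : #|[set q1; x]| = 2 by rewrite cards2; case/andP: (ee_qy ee1 xD) => ->.
have c2 : #|[set q2; y]| = 2 by rewrite cards2; case/andP: (ee_qy ee2 yD) => ->.
have pJ : profile [set: T] ([set q1; x] :|: [set q2; y]) 1.
  by apply: (join sp _ _ p1 p2); rewrite ?c1 ?c2.
have cJ : #|[set q1; x] :|: [set q2; y]| = 4 by rewrite (prof_dis sp p1 p2) c1 c2.
have d3 z : z \in [set q1; x] :|: [set q2; y] -> 3 <= dg [set: T] z.
  by move=> zJ; have := profile_dg star pJ zJ; rewrite cJ.
have dq1 := split_dg sp (ee_q ee1); rewrite (ee_dg ee1) in dq1.
have dq2 := split_dg sp' (ee_q ee2); rewrite (ee_dg ee2) in dq2.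
have h1 := leq_b1 (e q1 w); have h2 := leq_b1 (e q2 w).
have q1w : e w q1.
  by rewrite e_sym; have := d3 q1; rewrite !inE eqxx dq1 => /(_ isT); case: (e q1 w).
split=> //; first by apply: d3; rewrite !inE eqxx orbT.
have : #|T| <= wt [set: T] ([set q1; x] :|: [set q2; y]).
  apply: (star (u := q1)); rewrite ?(prof_indep pJ) //; first by rewrite !inE eqxx.
  by rewrite cJ dq1; slia.
rewrite wtU; last first.
  by apply: disjointW (prof_sub p1) (prof_sub p2) (spl_dis sp).
rewrite !wtU1 ?inE ?wt1; last 2 first.
- by case/andP: (ee_qy ee2 yD).
- by case/andP: (ee_qy ee1 xD).
have := split_card sp; rewrite cardsT (ee_sum ee1) (ee_sum ee2); slia.
Qed.

End Star.

Ltac decide_edges :=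
  try compute_non_edges; rewrite /=; do ?[apply/andP; split];
  first [ done
        | match goal with H : noedge _ _ |- _ => by apply: H; rewrite !inE eqxx ?orbT end
        | match goal with H : e ?x ?y = _ |- context [e ?x ?y] => by rewrite H end ].

Lemma F11_iso w A B w1 q1 q1' D1 w2 q2 q2' D2 : split_at [set: T] w A B ->
  ear_exc A w1 q1 q1' D1 -> ear_exc B w2 q2 q2' D2 ->
  e w q1 -> e w q1' -> e w q2 -> e w q2' -> K2_side w w1 D1 -> K2_side w w2 D2 ->
  isomorphic e (F11 (e w w1) (e w w2)).
Proof.
move=> sp ee1 ee2 wq1 wq1' wq2 wq2' [y [y' [ED1 cD1 eyy wD1]]] [z [z' [ED2 cD2 ezz wD2]]].
have [sp1 n1 eqq1 w1q w1q' _ _ _ _] := ee1; have [sp2 n2 eqq2 w2q w2q' _ _ _ _] := ee2.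
have EA := spl_eq sp1; have EB := spl_eq sp2; rewrite ED1 in EA; rewrite ED2 in EB.
have [wy w1y] : e w y /\ e w1 y by apply: wD1; rewrite ED1 !inE eqxx.
have [wy' w1y'] : e w y' /\ e w1 y' by apply: wD1; rewrite ED1 !inE eqxx orbT.
have [wz w2z] : e w z /\ e w2 z by apply: wD2; rewrite ED2 !inE eqxx.
have [wz' w2z'] : e w z' /\ e w2 z' by apply: wD2; rewrite ED2 !inE eqxx orbT.
have cT : #|T| = 11 by rewrite -cardsT (split_card sp) (ee_sum ee1) (ee_sum ee2) cD1 cD2.
have cov x : x \in [:: w; w1; w2; q1; q1'; y; y'; q2; q2'; z; z'].
  have := in_setT x; rewrite (spl_eq sp) EA EB !inE.
  by do 10![case: (x == _); rewrite ?orbT //=].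
have AB := spl_no sp; have BA := noedge_sym AB.
have F1 := spl_no sp1; have F2 := spl_no sp2.
rewrite ED1 in F1; rewrite ED2 in F2; rewrite EA EB in AB BA.
case E1: (e w w1); case E2: (e w w2);
  apply: (@isomorphic_edge_list _ _ e_sym e_irr _ _ w
    [:: w; w1; w2; q1; q1'; y; y'; q2; q2'; z; z']) => //; decide_edges.
Qed.

Lemma F12_iso w A B w1 q1 q1' D1 w2 q2 q2' D2 : split_at [set: T] w A B ->
  ear_exc A w1 q1 q1' D1 -> ear_exc B w2 q2 q2' D2 ->
  e w q1 -> e w q1' -> e w q2 -> e w q2' -> K2_side w w1 D1 -> P3_side w w2 D2 ->
  exists l1 l2 l3 l4 : bool, (l3 || l4) /\ isomorphic e (F12 l1 l2 l3 l4).
Proof.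
move=> sp ee1 ee2 wq1 wq1' wq2 wq2' [y [y' [ED1 cD1 eyy wD1]]].
case=> [z [c [z' [ED2 cD2 [ezc ez'c ezz] [wz w2z wz' w2z'] wc]]]].
have [sp1 n1 eqq1 w1q w1q' _ _ _ _] := ee1; have [sp2 n2 eqq2 w2q w2q' _ _ _ _] := ee2.
have EA := spl_eq sp1; have EB := spl_eq sp2; rewrite ED1 in EA; rewrite ED2 in EB.
have [wy w1y] : e w y /\ e w1 y by apply: wD1; rewrite ED1 !inE eqxx.
have [wy' w1y'] : e w y' /\ e w1 y' by apply: wD1; rewrite ED1 !inE eqxx orbT.
have cT : #|T| = 12 by rewrite -cardsT (split_card sp) (ee_sum ee1) (ee_sum ee2) cD1 cD2.
have cov x : x \in [:: w; w1; w2; q1; q1'; y; y'; q2; q2'; z; z'; c].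
  have := in_setT x; rewrite (spl_eq sp) EA EB !inE.
  by do 12![case: (x == _); rewrite ?orbT //=].
have AB := spl_no sp; have BA := noedge_sym AB.
have F1 := spl_no sp1; have F2 := spl_no sp2.
rewrite ED1 in F1; rewrite ED2 in F2; rewrite EA EB in AB BA.
exists (e w w1), (e w w2), (e w c), (e w2 c); split=> //.
case E1: (e w w1); case E2: (e w w2); case E3: (e w c); case E4: (e w2 c);
  apply: (@isomorphic_edge_list _ _ e_sym e_irr _ _ w
    [:: w; w1; w2; q1; q1'; y; y'; q2; q2'; z; z'; c]) => //; decide_edges.
Qed.

Lemma exc3_iso w A B : split_at [set: T] w A B -> exc2 A -> exc2 B ->
  (forall I u, indep I -> u \in I -> dg [set: T] u < #|I| -> #|T| <= wt [set: T] I) ->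
  (exists l1 l2 : bool, isomorphic e (F11 l1 l2)) \/
  (exists l1 l2 l3 l4 : bool, (l3 || l4) /\ isomorphic e (F12 l1 l2 l3 l4)).
Proof.
move=> sp [w1 [q1 [q1' [D1 ee1]]]] [w2 [q2 [q2' [D2 ee2]]]] star.
have sp' := split_atC sp; have ee1' := ear_excC ee1; have ee2' := ear_excC ee2.
have [x0 x0D] : exists x, x \in D1 by apply/set0Pn; rewrite -card_gt0; have := ee_card ee1; slia.
have [y0 y0D] : exists y, y \in D2 by apply/set0Pn; rewrite -card_gt0; have := ee_card ee2; slia.
have tight := exc3_tight star sp ee1 ee2; have tight' := exc3_tight star sp' ee2 ee1.
have [wq1 _ _] := tight x0 y0 x0D y0D; have [wq2 _ _] := tight' y0 x0 y0D x0D.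
have [wq1' _ _] := exc3_tight star sp ee1' ee2 x0D y0D.
have [wq2' _ _] := exc3_tight star sp' ee2' ee1 y0D x0D.
have degD X Y v r r' D : split_at [set: T] w X Y -> ear_exc X v r r' D ->
    forall x, x \in D -> dg [set: T] x = dg D x + e v x + e w x /\ dg [set: T] x <= #|D| + 1.
  move=> s ee x xD; rewrite (split_dg s (subsetP (ee_D ee) _ xD)) (ee_dgD ee xD).
  split; first by rewrite [e x v]e_sym [e x w]e_sym.
  have := dg_lt xD; have := leq_b1 (e x v); have := leq_b1 (e x w); slia.
have shape X Y v r r' D v' t t' E z : split_at [set: T] w X Y -> ear_exc X v r r' D ->
    ear_exc Y v' t t' E -> z \in E ->
    K2_side w v D \/ (P3_side w v D /\ exists2 x, x \in D & dg [set: T] x <= #|D|).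
  move=> s ee ee' zE; apply: side_shape (ee_connD ee) (ee_ntc ee) (ee_card ee) _ => x xD.
  have [Ex _] := degD _ _ _ _ _ _ s ee x xD.
  have [_ dz] := degD _ _ _ _ _ _ (split_atC s) ee' z zE.
  have [_ ge3 t3] := exc3_tight star s ee ee' xD zE; split=> //; slia.
case: (shape _ _ _ _ _ _ _ _ _ _ _ sp ee1 ee2 y0D) => [K1|[S1 [x xD dx]]];
  case: (shape _ _ _ _ _ _ _ _ _ _ _ sp' ee2 ee1 x0D) => [K2|[S2 [y yD dy]]].
- by left; exists (e w w1), (e w w2); apply: F11_iso sp ee1 ee2 _ _ _ _ K1 K2.
- by right; apply: F12_iso sp ee1 ee2 _ _ _ _ K1 S2.
- by right; apply: F12_iso sp' ee2 ee1 _ _ _ _ K2 S1.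
(* Two paths are impossible: the degrees of x and y would sum to at most #|D1| + #|D2|, one short of
   the bound. *)
by have [_ _] := exc3_tight star sp ee1 ee2 xD yD; slia.
Qed.

End Graph.

Theorem theorem1p8 (T : finType) (e : rel T)
  (e_sym : symmetric e) (e_irr : irreflexive e) :
  (if sigma_star e is Some s then (#|T| <= s : Prop) else True) ->
  (exists P : {set {set T}}, two_proper_partition e P /\ #|P| <= alpha_star e)
  \/ isomorphic e K2
  \/ isomorphic e F5
  \/ (exists l1 l2 : bool, isomorphic e (F11 l1 l2))
  \/ (exists l1 l2 l3 l4 : bool, (l3 || l4) /\ isomorphic e (F12 l1 l2 l3 l4))
  \/ (exists s t : nat, [/\ 2 <= s, s <= t, s + t + 2 = #|T| &
        exists withab : bool, isomorphic e (Hst s t withab)]).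
Proof.
move=> hs; have star I u := sigma_star_large (I := I) (u := u) hs.
have [T0|T0] := eqVneq [set: T] set0.
  left; exists set0; rewrite cards0; split=> //.
  by split=> [|B]; rewrite ?inE // T0 partition_set0.
case: (alternative e_sym e_irr T0) => [gT|lT|[e1|[e2|e3]]].
- by left; apply: star_good gT.
- by case: (star_not_low star lT).
- by right; left; apply: exc1_iso e1.
- case: e2 => w [q [q' [D ee]]]; have := ee_card ee; rewrite leq_eqVlt => /orP[/eqP D2|D2].
    by right; right; left; apply: (exc2_F5 e_sym e_irr star ee).
  by do 5!right; apply: (exc2_H e_sym e_irr star ee D2).
case: e3 => w [A [B [sp _ eA eB]]].
by case: (exc3_iso e_sym e_irr sp eA eB star) => ?; do 3!right; [left|right; left].
Qed.
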